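(* The following statements hold. (1) An instance of Dyck-2 reachability is a no-instance if and only if there exists a separator for it. (2) There is a deterministic algorithm that runs in time $O(|V|^\omega)$ and decides whether a given sextuple of $|V|\times|V|$ matrices is a separator for a given instance $(G,\lambda,s,t)$, $G=(V,E)$, of Dyck-2 reachability. (3) There is a randomized algorithm that runs in time $O(|V|^2)$ and decides whether a given sextuple of $|V|\times|V|$ matrices is a separator for a given instance $(G,\lambda,s,t)$, $G=(V,E)$, of Dyck-2 reachability, in the following sense: if the sextuple is a separator, the algorithm never errs (it accepts with probability $1$); otherwise it rejects with probability at least $0.5$.
   Context: Dyck-2 language: the language over the alphabet $\{\texttt{(},\texttt{)},\texttt{[},\texttt{]}\}$ generated by the grammar $S\to SS \mid \texttt{(}\,S\,\texttt{)} \mid \texttt{[}\,S\,\texttt{]} \mid \varepsilon$. Dyck-2 reachability: an instance $(G,\lambda,s,t)$ consists of a finite directed graph $G=(V,E)$, an edge labeling $\lambda\colon E\to\{\texttt{(},\texttt{)},\texttt{[},\texttt{]}\}$ and two vertices $s,t\in V$. A walk from $u$ to $v$ is a sequence of consecutive edges (vertices and edges may repeat) starting at $u$ and ending at $v$; the empty walk from $u$ to $u$ is allowed. A walk is valid if the concatenation of its edge labels is a word of the Dyck-2 language. The instance is a yes-instance if there is a valid walk from $s$ to $t$, and a no-instance otherwise. Assume $V=\{1,\ldots,|V|\}$. Notation: $A_{\texttt{(}},A_{\texttt{[}},A_{\texttt{)}},A_{\texttt{]}}$ are the $|V|\times|V|$ $0$–$1$ adjacency matrices of $G$ restricted to edges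 labeled $\texttt{(}$, $\texttt{[}$, $\texttt{)}$, $\texttt{]}$ respectively. For a nonnegative integer matrix $N$, $\mathrm{bool}(N)$ is obtained from $N$ by replacing every nonzero entry by $1$. $I$ is the $|V|\times|V|$ identity matrix. $A\le B$ denotes entrywise inequality. Matrix products are over the integers. Separator: a separator for the instance is a sextuple of $|V|\times|V|$ matrices $(M_S, M_{SS}, M_{\texttt{(}S}, M_{\texttt{[}S}, M_{\texttt{(}S\texttt{)}}, M_{\texttt{[}S\texttt{]}})$, all of whose entries belong to $\{0,1,\ldots,|V|^2\}$, with all entries of $M_S$ in $\{0,1\}$, satisfying the ten conditions $$I\le M_S,\quad A_{\texttt{(}}\cdot M_S=M_{\texttt{(}S},\quad A_{\texttt{[}}\cdot M_S=M_{\texttt{[}S},\quad M_S\cdot M_S=M_{SS},$$ $$M_{\texttt{(}S}\cdot A_{\texttt{)}}=M_{\texttt{(}S\texttt{)}},\quad M_{\texttt{[}S}\cdot A_{\texttt{]}}=M_{\texttt{[}S\texttt{]}},$$ $$\mathrm{bool}(M_{SS})\le M_S,\quad \mathrm{bool}(M_{\texttt{(}S\texttt{)}})\le M_S,\quad \mathrm{bool}(M_{\texttt{[}S\texttt{]}})\le M_S,\quad (M_S)_{s,t}=0.$$ $\omega<2.4$ is the matrix multiplication exponent, with the usual convention that two $n\times n$ integer matrices with entries polynomially bounded in $n$ can be multiplied in time $O(n^\omega)$. Running times are in the RAM model with unit-cost operations on $O(\log n)$-bit words. *)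

(* Defs.v *)
From HB Require Import structures.
From mathcomp Require Import all_boot all_order all_algebra.
From mathcomp Require Import all_classical all_reals all_analysis.

Set Implicit Arguments.
Unset Strict Implicit.
Unset Printing Implicit Defensive.

Import Order.TTheory GRing.Theory Num.Theory.

Local Open Scope ring_scope.

(** * Dyck-2 reachability *)

Inductive bracket := LRound | RRound | LSquare | RSquare.

Definition bracket_eqb (a b : bracket) : bool :=
  match a, b with
  | LRound, LRound | RRound, RRound
  | LSquare, LSquare | RSquare, RSquare => true
  | _, _ => false
  end.

Lemma bracket_eqP : Equality.axiom bracket_eqb.
Proof. by case; case; constructor. Qed.

HB.instance Definition _ := hasDecEq.Build bracket bracket_eqP.

Inductive dyck2 : seq bracket -> Prop :=
  | dyck2_cat u v : dyck2 u -> dyck2 v -> dyck2 (u ++ v)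
  | dyck2_round u : dyck2 u -> dyck2 (LRound :: u ++ [:: RRound])
  | dyck2_square u : dyck2 u -> dyck2 (LSquare :: u ++ [:: RSquare])
  | dyck2_nil : dyck2 [::].

(* The vertex set {1, ..., n} is ['I_n], numbered from 0. Edges form an
   arbitrary finite type, so loops and parallel edges are allowed; the graphs
   with E a subset of V * V are those where (src, tgt) is injective. *)
Record instance (n : nat) := Instance {
  edge : finType;
  src : edge -> 'I_n;
  tgt : edge -> 'I_n;
  lab : edge -> bracket;
  source : 'I_n;
  target : 'I_n
}.

Fixpoint walk n (G : instance n) (u : 'I_n) (p : seq (edge G)) (v : 'I_n)
    : bool :=
  match p with
  | [::] => u == v
  | e :: q => (src e == u) && walk (tgt e) q v
  end.

Definition yes_instance n (G : instance n) : Prop :=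
  exists p : seq (edge G),
    walk (source G) p (target G) /\ dyck2 [seq lab e | e <- p].

Definition no_instance n (G : instance n) : Prop := ~ yes_instance G.

(** * Separators *)

Definition b2z (b : bool) : int := if b then 1 else 0.

Definition adj n (G : instance n) (b : bracket) : 'M[int]_n :=
  \matrix_(i, j)
    b2z [exists e : edge G, [&& src e == i, tgt e == j & lab e == b]].

Definition boolmx n (N : 'M[int]_n) : 'M[int]_n :=
  \matrix_(i, j) b2z (N i j != 0).

Definition lemx n (A B : 'M[int]_n) : Prop := forall i j, A i j <= B i j.

Record sextuple (n : nat) := Sextuple {
  mS : 'M[int]_n;     (* M_S *)
  mSS : 'M[int]_n;    (* M_SS *)
  mRS : 'M[int]_n;    (* M_(S *)
  mQS : 'M[int]_n;    (* M_[S *)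
  mRSR : 'M[int]_n;   (* M_(S) *)
  mQSQ : 'M[int]_n    (* M_[S] *)
}.

Definition sextuple_seq n (M : sextuple n) : seq 'M[int]_n :=
  [:: mS M; mSS M; mRS M; mQS M; mRSR M; mQSQ M].

Record separator n (G : instance n) (M : sextuple n) : Prop := Separator {
  sep_range : forall N, N \in sextuple_seq M ->
    forall i j, 0 <= N i j <= (n ^ 2)%N%:Z;
  sep_range01 : forall i j, mS M i j = 0 \/ mS M i j = 1;
  sep_id : lemx 1%:M (mS M);
  sep_LRound : adj G LRound *m mS M = mRS M;
  sep_LSquare : adj G LSquare *m mS M = mQS M;
  sep_SS : mS M *m mS M = mSS M;
  sep_RRound : mRS M *m adj G RRound = mRSR M;
  sep_RSquare : mQS M *m adj G RSquare = mQSQ M;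
  sep_le_SS : lemx (boolmx (mSS M)) (mS M);
  sep_le_round : lemx (boolmx (mRSR M)) (mS M);
  sep_le_square : lemx (boolmx (mQSQ M)) (mS M);
  sep_st : mS M (source G) (target G) = 0
}.

(** * A unit-cost word RAM

    The machine has registers and an indirectly addressed memory, and its
    control flow is structured. The memory is divided into arrays named by
    constants of the program, so a program only uses finitely many of them
    (interleaving them in a single memory costs a constant factor).
    A w-bit word is a signed integer of absolute value less than 2 ^ w. A step
    whose result does not fit in a word has no successor: an overflowing run
    does not halt. *)

Inductive binop := Add | Sub | Mul | Div | Mod | Ltb | Eqb.

Definition binop_sem (o : binop) (x y : int) : int :=
  match o with
  | Add => x + y
  | Sub => x - y
  | Mul => x * y
  | Div => (x %/ y)%Z
  | Mod => (x %% y)%Z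
  | Ltb => b2z (x < y)
  | Eqb => b2z (x == y)
  end.

Inductive expr :=
  | Cst of int
  | Reg of nat
  | Read of nat & expr
  | Bin of binop & expr & expr.

Inductive cmd :=
  | Skip
  | Assign of nat & expr
  | Write of nat & expr & expr
  | Flip of nat
  | Seq of cmd & cmd
  | If of expr & cmd & cmd
  | While of expr & cmd.

Record state := State {
  regs : nat -> int;
  store : nat -> int -> int;
  coins : seq bool
}.

Definition set_reg (st : state) (r : nat) (x : int) : state :=
  State (fun r' => if r' == r then x else regs st r') (store st) (coins st).

Definition set_mem (st : state) (a : nat) (i x : int) : state :=
  State (regs st)
        (fun a' i' => if (a' == a) && (i' == i) then x else store st a' i')
        (coins st).

Definition is_word (w : nat) (x : int) : bool := (`|x| < 2 ^ w)%N.

Definition to_word (w : nat) (x : int) : option int :=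
  if is_word w x then Some x else None.

Fixpoint eval (w : nat) (st : state) (e : expr) : option int :=
  match e with
  | Cst z => to_word w z
  | Reg r => to_word w (regs st r)
  | Read a e1 => obind (fun i => to_word w (store st a i)) (eval w st e1)
  | Bin o e1 e2 =>
      obind (fun x => obind (fun y => to_word w (binop_sem o x y))
                            (eval w st e2))
            (eval w st e1)
  end.

(* The number of unit-cost operations performed when evaluating [e]. *)
Fixpoint cost (e : expr) : nat :=
  match e with
  | Cst _ | Reg _ => 1
  | Read _ e1 => (cost e1).+1
  | Bin _ e1 e2 => (cost e1 + cost e2).+1
  end.

(* [exec w P st t st']: on [w]-bit words, [P] started in [st] halts in [st']
   after exactly [t] steps. [Flip] consumes one coin and is stuck if none is
   left; a run started with no coins is therefore a deterministic computation,
   and a run of at most T steps uses at most T coins. *)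
Inductive exec (w : nat) : cmd -> state -> nat -> state -> Prop :=
  | exec_skip st : exec w Skip st 1 st
  | exec_assign st r e x :
      eval w st e = Some x ->
      exec w (Assign r e) st (cost e).+1 (set_reg st r x)
  | exec_store st a e1 e2 i x :
      eval w st e1 = Some i -> eval w st e2 = Some x ->
      exec w (Write a e1 e2) st (cost e1 + cost e2).+1 (set_mem st a i x)
  | exec_flip rs m (b : bool) cs r :
      exec w (Flip r) (State rs m (b :: cs)) 1
           (set_reg (State rs m cs) r (b2z b))
  | exec_seq P1 P2 st1 st2 st3 t1 t2 :
      exec w P1 st1 t1 st2 -> exec w P2 st2 t2 st3 ->
      exec w (Seq P1 P2) st1 (t1 + t2) st3
  | exec_if st st' e x P1 P2 t :
      eval w st e = Some x ->
      exec w (if x != 0 then P1 else P2) st t st' ->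
      exec w (If e P1 P2) st (cost e + t).+1 st'
  | exec_while_stop st e P :
      eval w st e = Some 0 ->
      exec w (While e P) st (cost e).+1 st
  | exec_while_loop st1 st2 st3 e x P t1 t2 :
      eval w st1 e = Some x -> x != 0 ->
      exec w P st1 t1 st2 -> exec w (While e P) st2 t2 st3 ->
      exec w (While e P) st1 (cost e + t1 + t2).+1 st3.

(* Words of O(log n) bits, with constant factor [d]. *)
Definition wordsize (d n : nat) : nat := (d * (trunc_log 2 n).+1)%N.

Definition mx_words (w n : nat) (A : 'M[int]_n) : Prop :=
  forall i j, is_word w (A i j).

(* Row-major layout, 0 outside the matrix. *)
Definition rowmajor n (A : 'M[int]_n) (k : int) : int :=
  if [pick p : 'I_n * 'I_n | k == (p.1 * n + p.2)%N%:Z] is Some p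
  then A p.1 p.2 else 0.

Definition load_matrices n (s : seq 'M[int]_n) (a : nat) : int -> int :=
  rowmajor (nth 0 s a).

(** * Matrix multiplication *)

Definition matmul_input n (A B : 'M[int]_n) : state :=
  State (nth 0 [:: n%:Z]) (load_matrices [:: A; B]) [::].

(* The convention on the matrix multiplication exponent omega: two n x n integer
   matrices with entries polynomially bounded in n can be multiplied in time
   O(n ^ omega). The product is returned in array 2. [C] does not depend on the
   word size; by the overflow rule, more bits never change a halting run. *)
Definition matmul_exponent (R : realType) (omega : R) : Prop :=
  forall k : nat, exists (P : cmd) (d0 C : nat),
    forall (d n : nat) (A B : 'M[int]_n), (d0 <= d)%N -> (0 < n)%N ->
      (forall i j, `|A i j| <= (n.+1 ^ k)%N%:Z) ->
      (forall i j, `|B i j| <= (n.+1 ^ k)%N%:Z) ->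
      exists (t : nat) (st : state),
        [/\ exec (wordsize d n) P (matmul_input A B) t st,
            t%:R <= C%:R * powR n%:R omega :> R &
            forall i j : 'I_n, store st 2 (i * n + j)%N%:Z = (A *m B) i j].

(** * Deciding separators *)

Definition separator_input n (G : instance n) (M : sextuple n)
    (cs : seq bool) : state :=
  State (nth 0 [:: n%:Z; (source G : nat)%:Z; (target G : nat)%:Z])
        (load_matrices ([:: adj G LRound; adj G LSquare;
                            adj G RRound; adj G RSquare] ++ sextuple_seq M))
        cs.

Definition sextuple_words (w n : nat) (M : sextuple n) : Prop :=
  forall N, N \in sextuple_seq M -> mx_words w N.

(* The verdict is returned in register 0: 1 to accept, 0 to reject. *)
Definition outputs (st : state) (verdict : bool) : Prop :=
  regs st 0 = b2z verdict.

Definition halts_within (w : nat) (P : cmd) (st : state) (T : nat)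
    (verdict : bool) : Prop :=
  exists (t : nat) (st' : state),
    [/\ exec w P st t st', (t <= T)%N & outputs st' verdict].

(* Probability over T independent fair coins. *)
Definition coin_prob (R : realType) (T : nat) (E : T.-tuple bool -> Prop) : R :=
  #|[set cs : T.-tuple bool | `[< E cs >]]|%:R / (2 ^ T)%N%:R.

Definition separator_decided_in_time (R : realType) (omega : R) : Prop :=
  exists (P : cmd) (d0 C : nat),
    forall (d n : nat) (G : instance n) (M : sextuple n),
      (d0 <= d)%N -> sextuple_words (wordsize d n) M ->
      exists (t : nat) (st : state),
        [/\ exec (wordsize d n) P (separator_input G M [::]) t st,
            t%:R <= C%:R * powR n%:R omega :> R &
            outputs st `[< separator G M >]].

Definition separator_rand_decided_in_quadratic_time (R : realType) : Prop :=
  exists (P : cmd) (d0 C : nat),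
    forall (d n : nat) (G : instance n) (M : sextuple n),
      (d0 <= d)%N -> sextuple_words (wordsize d n) M ->
      let T := (C * n ^ 2)%N in
      let run (cs : T.-tuple bool) (verdict : bool) :=
        halts_within (wordsize d n) P (separator_input G M cs) T verdict in
      [/\ forall cs, exists verdict, run cs verdict,
          separator G M -> coin_prob R (fun cs => run cs true) = 1 &
          ~ separator G M -> coin_prob R (fun cs => run cs false) >= 1 / 2].

(* Main.v *)
(* A no-instance has as separator the reachability matrix of valid walks;
   conversely M_S of a separator is positive on every pair joined by a valid
   walk, by induction on the Dyck-2 word.

   Both algorithms first check every condition except the five matrix products
   in one pass over the entries; this also bounds all entries by n ^ 2, so that
   nothing overflows afterwards. The deterministic algorithm then runs five
   copies of the matrix multiplication program, each renamed to its own
   registers and arrays; the O(n ^ 2) overhead is absorbed because omega >= 2, a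
   program needing one step for each nonzero entry it writes. The randomized
   algorithm replaces each product X Y = Z by Freivalds' test X (Y u) = Z u for
   one random 0-1 vector u common to the five products. *)

Require Import Defs.
From mathcomp Require Import all_boot all_order all_algebra.
From mathcomp Require Import all_classical all_reals all_analysis.
From mathcomp Require Import zify.

Import Defs.

Set Implicit Arguments.
Unset Strict Implicit.
Unset Printing Implicit Defensive.

Import Order.TTheory GRing.Theory Num.Theory.

Local Open Scope ring_scope.

(** * Nonnegative integer matrices *)

(** The constraint that shapes both programs is that an overflowing run is stuck, while the given
    sextuple may consist of arbitrary words, negative or huge. So the first pass may only compare
    entries, and any arithmetic on them has to wait until they are known to lie in [0, n ^ 2]. From
    then on every value has a fixed polynomial bound: [n ^ 5] for an entry of a product, [n ^ 6] for
    an entry of X (Y u). This is why a word size of [d] logarithms with [d >= 8] is enough.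

    The bound n ^ 2 in the definition of a separator is the one that the doubly wrapped products of
    0-1 matrices satisfy.

    Sharing one random vector among the five products does not weaken the error bound: a single
    violated product is already detected with probability at least 1 / 2, and the other four tests
    can only add rejections.

    The multiplication program is known only through its behaviour from a prescribed initial state,
    zero outside its input. Calling it inside a larger program therefore requires memory that is
    still zero and a simulation argument for renamed programs. *)

Lemma b2z_ge0 b : 0 <= b2z b. Proof. by case: b. Qed.

Lemma b2z_le1 b : b2z b <= 1. Proof. by case: b. Qed.

Lemma b2z_eq0 b : (b2z b == 0) = ~~ b. Proof. by case: b. Qed.

Lemma b2zM b c : b2z b * b2z c = b2z (b && c).
Proof. by case: b; case: c. Qed.

Lemma mulmx_ge0 m n p (A : 'M[int]_(m, n)) (B : 'M[int]_(n, p)) :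
  (forall i j, 0 <= A i j) -> (forall i j, 0 <= B i j) ->
  forall i j, 0 <= (A *m B) i j.
Proof. by move=> A0 B0 i j; rewrite mxE sumr_ge0 // => k _; rewrite mulr_ge0. Qed.

Lemma mulmx_le m n p (A : 'M[int]_(m, n)) (B : 'M[int]_(n, p)) (a b : nat) :
  (forall i j, 0 <= A i j <= a%:Z) -> (forall i j, 0 <= B i j <= b%:Z) ->
  forall i j, 0 <= (A *m B) i j <= (n * (a * b))%N%:Z.
Proof.
move=> HA HB i j; apply/andP; split.
  by apply: mulmx_ge0 => k l; [case/andP: (HA k l) | case/andP: (HB k l)].
rewrite mxE (@le_trans _ _ (\sum_(k < n) (a * b)%N%:Z)) //.
  apply: ler_sum => k _; rewrite PoszM.
  by case/andP: (HA i k) (HB k j) => ? ? /andP[? ?]; rewrite ler_pM.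
by rewrite sumr_const card_ord -[n in (_ <= (n * _)%:Z)]/n PoszM -mulr_natl natz.
Qed.

Lemma mulmx_gt0 m n p (A : 'M[int]_(m, n)) (B : 'M[int]_(n, p)) i k j :
  (forall i j, 0 <= A i j) -> (forall i j, 0 <= B i j) ->
  0 < A i k -> 0 < B k j -> 0 < (A *m B) i j.
Proof.
move=> A0 B0 Aik Bkj; rewrite mxE (bigD1 k) //= ltr_pwDl ?mulr_gt0 //.
by rewrite sumr_ge0 // => l _; rewrite mulr_ge0.
Qed.

Lemma mulmx_neq0 m n p (A : 'M[int]_(m, n)) (B : 'M[int]_(n, p)) i j :
  (A *m B) i j != 0 -> exists2 k, A i k != 0 & B k j != 0.
Proof.
move=> AB0; apply/exists2P; apply: contrapT => noP.
case/negP: AB0; rewrite mxE big1 // => k _; apply/eqP; rewrite mulf_eq0.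
apply: contrapT => /negP; rewrite negb_or => /andP[Aik Bkj].
by apply: noP; exists k.
Qed.

Lemma adj_range n (G : instance n) b i j : 0 <= adj G b i j <= 1%N%:Z.
Proof. by rewrite mxE b2z_ge0 b2z_le1. Qed.

Lemma adj_neq0P n (G : instance n) b i j :
  reflect (exists2 e : edge G, (src e = i /\ tgt e = j) & lab e = b)
          (adj G b i j != 0).
Proof.
rewrite mxE b2z_eq0 negbK; apply: (iffP existsP) => [[e /and3P[]]|[e [<- <-] <-]].
  by do 3![move/eqP=> ?]; exists e.
by exists e; rewrite !eqxx.
Qed.

(** * Separators certify unreachability *)

Lemma walk_cat n (G : instance n) (p q : seq (edge G)) u v :
  walk u (p ++ q) v <-> exists2 x, walk u p x & walk x q v.
Proof.
elim: p u => [|e p IHp] u /=.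
  by split=> [uv|[x /eqP->]//]; exists u; rewrite /= ?eqxx.
split=> [/andP[-> /IHp[x px qx]]|[x /andP[-> px] qx]]; first by exists x.
by apply/IHp; exists x.
Qed.

Definition valid_walk n (G : instance n) (u v : 'I_n) : Prop :=
  exists2 p : seq (edge G), walk u p v & dyck2 [seq lab e | e <- p].

Definition reach_mx n (G : instance n) : 'M[int]_n :=
  \matrix_(i, j) b2z `[< valid_walk G i j >].

Definition reach_sextuple n (G : instance n) : sextuple n :=
  let N := reach_mx G in
  let RN := adj G LRound *m N in let QN := adj G LSquare *m N in
  Sextuple N (N *m N) RN QN (RN *m adj G RRound) (QN *m adj G RSquare).

Lemma reach_neq0P n (G : instance n) i j :
  reflect (valid_walk G i j) (reach_mx G i j != 0).
Proof. by rewrite mxE b2z_eq0 negbK; apply: asboolP. Qed.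

Lemma reach_range n (G : instance n) i j : 0 <= reach_mx G i j <= 1%N%:Z.
Proof. by rewrite mxE b2z_ge0 b2z_le1. Qed.

Lemma boolmx_le_reach n (G : instance n) (N : 'M[int]_n) :
  (forall i j, N i j != 0 -> valid_walk G i j) -> lemx (boolmx N) (reach_mx G).
Proof.
move=> NG i j; rewrite !mxE.
have [/NG w|_] := boolP (N i j != 0); last exact: b2z_ge0.
by have -> : `[< valid_walk G i j >] by apply/asboolP.
Qed.

Lemma valid_walk_cat n (G : instance n) u v x :
  valid_walk G u x -> valid_walk G x v -> valid_walk G u v.
Proof.
move=> [p px dp] [q qv dq]; exists (p ++ q); first by apply/walk_cat; exists x.
by rewrite map_cat; apply: dyck2_cat.
Qed.

(** Closure of the Dyck language under wrapping is a hypothesis here, so one proof serves round and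
    square brackets. *)
Lemma valid_walk_wrap n (G : instance n) (l r : bracket) u x y v :
    (forall s, dyck2 s -> dyck2 (l :: s ++ [:: r])) ->
  adj G l u x != 0 -> valid_walk G x y -> adj G r y v != 0 -> valid_walk G u v.
Proof.
move=> lr /adj_neq0P[e [se te] le] [p pw dp] /adj_neq0P[f [sf tf] lf].
exists (e :: p ++ [:: f]).
  rewrite /= se eqxx te /=; apply/walk_cat; exists y => //.
  by rewrite /= sf tf !eqxx.
by rewrite /= map_cat /= le lf; apply: lr.
Qed.

(** For the ranges: a product of two 0-1 matrices has entries at most [n], and one more 0-1 factor
    gives at most [n * n]. The inequalities state that valid walks are closed under concatenation
    and wrapping. *)
Lemma reach_separator n (G : instance n) :
  no_instance G -> separator G (reach_sextuple G).
Proof.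
move=> noG.
have n1 : (1 <= n)%N := leq_ltn_trans (leq0n _) (ltn_ord (source G)).
have RN b := mulmx_le (adj_range G b) (reach_range G).
have wrap l r : (forall s, dyck2 s -> dyck2 (l :: s ++ [:: r])) ->
    lemx (boolmx (adj G l *m reach_mx G *m adj G r)) (reach_mx G).
  move=> lr; apply: boolmx_le_reach => i j /mulmx_neq0[y /mulmx_neq0[x]].
  by move=> Aix /reach_neq0P wxy Ayj; apply: valid_walk_wrap lr Aix wxy Ayj.
split=> //=.
- move=> N; rewrite /sextuple_seq /= !inE => HN i j.
  have /andP[-> le1] : 0 <= N i j <= (n * n)%N%:Z; last by rewrite -mulnn.
  case/predU1P: HN => [->|].
    by have /andP[-> /le_trans->] := reach_range G i j; rewrite ?lez_nat ?muln_gt0 ?n1.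
  case/predU1P => [->|].
    have /andP[-> /le_trans->//] := mulmx_le (reach_range G) (reach_range G) i j.
    by rewrite lez_nat !muln1 leq_pmulr.
  case/predU1P => [->|].
    by have /andP[-> /le_trans->//] := RN LRound i j; rewrite lez_nat !muln1 leq_pmulr.
  case/predU1P => [->|].
    by have /andP[-> /le_trans->//] := RN LSquare i j; rewrite lez_nat !muln1 leq_pmulr.
  case/predU1P => [->|/eqP->].
    have /andP[-> /le_trans->//] := mulmx_le (RN LRound) (adj_range G RRound) i j.
    by rewrite lez_nat !muln1.
  have /andP[-> /le_trans->//] := mulmx_le (RN LSquare) (adj_range G RSquare) i j.
  by rewrite lez_nat !muln1.
- by move=> i j; rewrite mxE; case: asboolP; [right | left].
- move=> i j; rewrite !mxE; case: eqVneq => [->|_] /=; last exact: b2z_ge0.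
  suff -> : `[< valid_walk G j j >] by [].
  by apply/asboolP; exists [::] => //=; apply: dyck2_nil.
- apply: boolmx_le_reach => i j /mulmx_neq0[k /reach_neq0P wik /reach_neq0P].
  exact: valid_walk_cat.
- by apply: wrap; apply: dyck2_round.
- by apply: wrap; apply: dyck2_square.
- by rewrite mxE; case: asboolP => // -[p pw dp]; case: noG; exists p.
Qed.

(** Nonnegativity carries the induction: a walk cut at an intermediate vertex contributes a positive
    summand to the entry of the product, and no other summand can cancel it. The walk and its
    endpoints are quantified after the word, because a concatenation splits one walk into two with
    new endpoints. *)
Lemma separator_walk n (G : instance n) (M : sextuple n) :
    separator G M ->
  forall s, dyck2 s -> forall (p : seq (edge G)) u v,
    [seq lab e | e <- p] = s -> walk u p v -> 0 < mS M u v.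
Proof.
move=> sep.
have S0 i j : 0 <= mS M i j.
  by case/andP: (sep_range sep (mem_head _ _) i j).
have A0 b i j : 0 <= adj G b i j by case/andP: (adj_range G b i j).
have boolP (N : 'M[int]_n) i j : lemx (boolmx N) (mS M) -> 0 < N i j -> 0 < mS M i j.
  move=> le /gt_eqF nz; apply: lt_le_trans (le i j).
  by rewrite mxE nz.
have edgeP (e : edge G) : 0 < adj G (lab e) (src e) (tgt e).
  by rewrite lt_def A0 andbT; apply/adj_neq0P; exists e.
have wrap (e f : edge G) (q : seq (edge G)) u v :
    (forall u v, walk u q v -> 0 < mS M u v) ->
    walk u (e :: q ++ [:: f]) v ->
    0 < (adj G (lab e) *m mS M *m adj G (lab f)) u v.
  move=> IHq /= /andP[/eqP <- /walk_cat[x wq /=]] /andP[/eqP sf /eqP <-].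
  apply: (@mulmx_gt0 _ _ _ _ _ _ x) => //; last by rewrite -sf.
    exact: mulmx_ge0.
  by apply: (@mulmx_gt0 _ _ _ _ _ _ (tgt e)) => //; apply: IHq.
(* The outer brackets of the word are traced back to the first and the last edge of the walk. *)
have lastP' (p : seq (edge G)) l r s : map (@lab n G) p = l :: s ++ [:: r] ->
    exists e q f, [/\ p = e :: q ++ [:: f], lab e = l, lab f = r
                   & map (@lab n G) q = s].
  case: p => // e p [le]; case/lastP: p => [|q f]; first by case: s.
  rewrite map_rcons -cats1 => E.
  have := congr1 (@rev _) E; rewrite !rev_cat /= => -[lf /(can_inj revK) qs].
  by exists e, q, f; rewrite cats1.
move=> s; elim=> {s} [s1 s2 _ IH1 _ IH2|s _ IHs|s _ IHs|] p u v.
- move=> ps; rewrite -[p](cat_take_drop (size s1)) => /walk_cat[x w1 w2].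
  apply: (boolP _ _ _ (sep_le_SS sep)); rewrite -(sep_SS sep).
  apply: (mulmx_gt0 S0 S0 (IH1 _ _ _ _ w1) (IH2 _ _ _ _ w2)).
    by rewrite map_take ps take_size_cat.
  by rewrite map_drop ps drop_size_cat.
- case/lastP'=> e [q [f [-> le lf qs]]] w.
  apply: (boolP _ _ _ (sep_le_round sep)).
  rewrite -(sep_RRound sep) -(sep_LRound sep) -le -lf.
  by apply: wrap w => u' v'; apply: IHs.
- case/lastP'=> e [q [f [-> le lf qs]]] w.
  apply: (boolP _ _ _ (sep_le_square sep)).
  rewrite -(sep_RSquare sep) -(sep_LSquare sep) -le -lf.
  by apply: wrap w => u' v'; apply: IHs.
- case: p => // _ /= /eqP->; apply: lt_le_trans (sep_id sep v v).
  by rewrite mxE eqxx.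
Qed.

Lemma no_instanceP n (G : instance n) :
  no_instance G <-> exists M : sextuple n, separator G M.
Proof.
split=> [noG|[M sep] [p [w d]]].
  by exists (reach_sextuple G); apply: reach_separator.
by have := separator_walk sep d (erefl _) w; rewrite (sep_st sep) ltxx.
Qed.

(** * Running times of word RAM programs *)

Lemma to_wordE w x : is_word w x -> to_word w x = Some x.
Proof. by rewrite /to_word => ->. Qed.

Lemma is_word_nat w (m : nat) : is_word w m%:Z = (m < 2 ^ w)%N.
Proof. by []. Qed.

Lemma is_word_le w (x y : int) :
  0 <= x <= y -> is_word w y -> is_word w x.
Proof. by rewrite /is_word => /andP[x0 xy]; apply: leq_ltn_trans; lia. Qed.

Lemma is_word_b2z w b : (0 < w)%N -> is_word w (b2z b).
Proof.
by move=> w0; rewrite /is_word; case: b; rewrite ?expn_gt0 //= -(expn0 2) ltn_exp2l.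
Qed.

Lemma eval_cst w st z : is_word w z -> eval w st (Cst z) = Some z.
Proof. exact: to_wordE. Qed.

Lemma eval_reg w st r x : regs st r = x -> is_word w x ->
  eval w st (Reg r) = Some x.
Proof. by move=> <-; apply: to_wordE. Qed.

Lemma eval_read w st a e i x :
  eval w st e = Some i -> store st a i = x -> is_word w x ->
  eval w st (Read a e) = Some x.
Proof. by move=> /= -> /= ->; apply: to_wordE. Qed.

Lemma eval_bin w st o e1 e2 x1 x2 x :
  eval w st e1 = Some x1 -> eval w st e2 = Some x2 ->
  binop_sem o x1 x2 = x -> is_word w x -> eval w st (Bin o e1 e2) = Some x.
Proof. by move=> /= -> /= -> /= ->; apply: to_wordE. Qed.

(** Total correctness with an upper bound on the time. Since [Q] is an arbitrary predicate on
    states, the run of a second command can itself be the postcondition of the first, which is how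
    [runs_seq] chains commands. *)
Definition runs (w : nat) (P : cmd) (st : state) (T : nat)
    (Q : state -> Prop) : Prop :=
  exists t st', [/\ exec w P st t st', (t <= T)%N & Q st'].

Lemma runs_weaken w P st T1 T2 (Q1 Q2 : state -> Prop) :
  (T1 <= T2)%N -> (forall s, Q1 s -> Q2 s) ->
  runs w P st T1 Q1 -> runs w P st T2 Q2.
Proof.
by move=> leT Q12 [t [s [Hs le HQ]]]; exists t, s; split=> //; [apply: leq_trans leT | apply: Q12].
Qed.

Lemma runs_skip w st (Q : state -> Prop) : Q st -> runs w Skip st 1 Q.
Proof. by exists 1, st; split=> //; apply: exec_skip. Qed.

Lemma runs_assign w st r e x (Q : state -> Prop) :
  eval w st e = Some x -> Q (set_reg st r x) ->
  runs w (Assign r e) st (cost e).+1 Q.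
Proof. by move=> ev HQ; do 2![eexists]; split; [apply: exec_assign ev | | ]. Qed.

Lemma runs_write w st a e1 e2 i x (Q : state -> Prop) :
  eval w st e1 = Some i -> eval w st e2 = Some x -> Q (set_mem st a i x) ->
  runs w (Write a e1 e2) st (cost e1 + cost e2).+1 Q.
Proof. by move=> ev1 ev2 HQ; do 2![eexists]; split; [apply: exec_store ev1 ev2 | | ]. Qed.

Lemma runs_flip w st r b cs (Q : state -> Prop) :
  coins st = b :: cs ->
  Q (set_reg (State (regs st) (store st) cs) r (b2z b)) ->
  runs w (Flip r) st 1 Q.
Proof.
case: st => rs m c /= -> HQ; do 2![eexists]; split; [exact: exec_flip | by [] | by []].
Qed.

Lemma runs_seq w P1 P2 st T1 T2 (Q : state -> Prop) :
  runs w P1 st T1 (fun s => runs w P2 s T2 Q) ->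
  runs w (Seq P1 P2) st (T1 + T2) Q.
Proof.
move=> [t1 [s1 [E1 le1 [t2 [s2 [E2 le2 HQ]]]]]].
by exists (t1 + t2)%N, s2; split; [apply: exec_seq E1 E2 | apply: leq_add |].
Qed.

Lemma runs_if w st e (b : bool) P1 P2 T (Q : state -> Prop) :
  eval w st e = Some (b2z b) -> runs w (if b then P1 else P2) st T Q ->
  runs w (If e P1 P2) st (cost e + T).+1 Q.
Proof.
move=> ev [t [s [E le HQ]]]; exists (cost e + t).+1, s; split=> //.
  by apply: exec_if ev _; rewrite b2z_eq0 negbK.
by rewrite ltnS leq_add2l.
Qed.

(** * Counting loops and the state they leave unchanged *)

Definition For (r : nat) (e : expr) (P : cmd) : cmd :=
  Seq (Assign r (Cst 0))
      (While (Bin Ltb (Reg r) e) (Seq P (Assign r (Bin Add (Reg r) (Cst 1))))).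

(** The bound [e] is evaluated again at each test, so [cost e] is paid in every iteration; test and
    increment take 7 further steps, rounded up to 10. The body has to leave the counter as it found
    it. The counter ends at [m] itself, hence [m < 2 ^ w]. *)
Lemma runs_for w r e P m T (Inv : nat -> state -> Prop) st :
    (0 < w)%N -> (m < 2 ^ w)%N ->
    (forall i s, (i <= m)%N -> Inv i s -> regs s r = i%:Z /\ eval w s e = Some m%:Z) ->
    Inv 0%N (set_reg st r 0) ->
    (forall i s, (i < m)%N -> Inv i s ->
       runs w P s T (fun s' => regs s' r = i%:Z /\ Inv i.+1 (set_reg s' r i.+1))) ->
  runs w (For r e P) st (m * (T + cost e + 10) + (cost e + 10)) (Inv m).
Proof.
move=> w0 wm Inv_e Inv0 InvS.
have loop k i s : (k + i = m)%N -> Inv i s ->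
    runs w (While (Bin Ltb (Reg r) e) (Seq P (Assign r (Bin Add (Reg r) (Cst 1)))))
      s (k * (T + cost e + 10) + (cost e + 5)) (Inv m).
  elim: k i s => [|k IHk] i s.
    rewrite add0n => -> Invm; have [sr se] := Inv_e _ _ (leqnn m) Invm.
    exists (cost (Bin Ltb (Reg r) e)).+1, s; split=> //=; last by lia.
    apply: exec_while_stop.
    apply: (eval_bin (eval_reg sr _) se) => //=; first by rewrite ltxx.
    exact: (is_word_b2z false).
  move=> kim Invi; have im : (i < m)%N by lia.
  have [sr se] := Inv_e _ _ (ltnW im) Invi.
  have [t1 [s1 [E1 le1 [s1r Inv1]]]] := InvS _ _ im Invi.
  have [|t2 [s2 [E2 le2 HQ]]] := IHk i.+1 _ _ Inv1; first by rewrite addnS.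
  exists (cost (Bin Ltb (Reg r) e) + (t1 + (cost (Bin Add (Reg r) (Cst 1))).+1) + t2).+1, s2.
  split=> //; last by rewrite /= mulSn; lia.
  have iw : is_word w i%:Z by rewrite is_word_nat (ltn_trans im).
  apply: (exec_while_loop (x := 1)) => //; last first.
  - exact: E2.
  - apply: exec_seq E1 _; apply: exec_assign.
    apply: (eval_bin (eval_reg s1r iw) (eval_cst _ (is_word_b2z true w0))).
      by rewrite /= addrC -intS.
    by rewrite is_word_nat (leq_ltn_trans im).
  - apply: (eval_bin (eval_reg sr iw) se); first by rewrite /= ltz_nat im.
    exact: (is_word_b2z true).
have -> : (m * (T + cost e + 10) + (cost e + 10) = 
  (cost (Cst 0)).+1 + (m * (T + cost e + 10) + (cost e + 8)))%N by rewrite /=; lia.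
apply: runs_seq; apply: runs_assign.
  by apply: eval_cst; rewrite (is_word_b2z false).
by apply: runs_weaken (loop m 0%N _ _ Inv0) => //; rewrite ?addn0 ?leq_add2l.
Qed.

(** [R] and [A] list the registers and arrays that may change. Everything else survives, including
    the coins. *)
Definition frame (R A : seq nat) (st st' : state) : Prop :=
  [/\ forall r, r \notin R -> regs st' r = regs st r,
      forall a, a \notin A -> store st' a = store st a &
      coins st' = coins st].

Lemma frame_trans R A st1 st2 st3 :
  frame R A st1 st2 -> frame R A st2 st3 -> frame R A st1 st3.
Proof.
move=> [r1 a1 c1] [r2 a2 c2]; split=> [r nr|a na|]; last by rewrite c2.
  by rewrite r2 // r1.
by rewrite a2 // a1.
Qed.

Lemma frame_sub (R A R' A' : seq nat) st st' :
  {subset R <= R'} -> {subset A <= A'} ->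
  frame R A st st' -> frame R' A' st st'.
Proof.
move=> sR sA [r1 a1 c1]; split=> // [r nr|a na].
  by apply: r1; apply: contra nr; apply: sR.
by apply: a1; apply: contra na; apply: sA.
Qed.

Lemma frame_set_reg R A st st' r x :
  r \in R -> frame R A st st' -> frame R A st (set_reg st' r x).
Proof.
move=> rR [r1 a1 c1]; split=> //= r' nr; case: eqP => [E|_]; last exact: r1.
by rewrite E rR in nr.
Qed.

Lemma frame_set_mem R A st st' a i x :
  a \in A -> frame R A st st' -> frame R A st (set_mem st' a i x).
Proof.
move=> aA [r1 a1 c1]; split=> //= a' na; rewrite -(a1 a') //.
by apply/funext => i' /=; case: eqP => [E|//]; rewrite E aA in na.
Qed.

(* Register 3 is the running verdict, register 4 the loop counter. *)
Definition AllLoop (bound e : expr) : cmd :=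
  For 4 bound (Assign 3 (Bin Mul (Reg 3) e)).

(** The hypotheses on [bound] and [e] range over all states that differ from [st] only in registers
    3 and 4, since the loop changes nothing else. There is no early exit: a failed test only turns
    the running product to 0. *)
Lemma runs_all w st bound e m (b : bool) (f : nat -> bool) :
    (0 < w)%N -> (m < 2 ^ w)%N -> regs st 3 = b2z b ->
    (forall s, frame [:: 3; 4]%N [::] st s -> eval w s bound = Some m%:Z) ->
    (forall i s, (i < m)%N -> frame [:: 3; 4]%N [::] st s -> regs s 4 = i%:Z ->
      eval w s e = Some (b2z (f i))) ->
  runs w (AllLoop bound e) st (m * (cost e + cost bound + 13) + (cost bound + 10))
    (fun s => frame [:: 3; 4]%N [::] st s /\ regs s 3 = b2z (b && all f (iota 0 m))).
Proof.
move=> w0 wm st3 evb eve.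
pose Inv i s := [/\ frame [:: 3; 4]%N [::] st s, regs s 4 = i%:Z
                  & regs s 3 = b2z (b && all f (iota 0 i))].
apply: (@runs_weaken _ _ _ (m * ((cost e).+3 + cost bound + 10) + (cost bound + 10)) _ (Inv m)).
- lia.
- by move=> s [].
apply: runs_for => //.
- by move=> i s im [fr s4 s3]; split=> //; apply: evb.
- by split=> //; [apply: frame_set_reg | rewrite /= andbT].
move=> i s im [fr s4 s3].
apply: (@runs_weaken _ _ _ (cost (Bin Mul (Reg 3) e)).+1) => [|s'|]; first by [].
  by apply.
apply: (runs_assign (x := b2z (b && all f (iota 0 i) && f i))).
  apply: eval_bin (eve i s im fr s4) _ _; first exact: eval_reg s3 (is_word_b2z _ w0).
    exact: b2zM.
  exact: is_word_b2z.
have E : all f (iota 0 i.+1) = all f (iota 0 i) && f i.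
  by rewrite -(addn1 i) iotaD all_cat /= andbT.
by split=> //; split; [do 2![apply: frame_set_reg => //] | | rewrite E /= andbA].
Qed.

Definition Not (e : expr) : expr := Bin Eqb e (Cst 0).

(** A product of 0-1 values, without short-circuiting: every conjunct must evaluate without overflow
    even when an earlier one is false. *)
Fixpoint Conj (s : seq expr) : expr :=
  if s is e :: s' then Bin Mul e (Conj s') else Cst 1.

Lemma eval_not w st e b : (0 < w)%N ->
  eval w st e = Some (b2z b) -> eval w st (Not e) = Some (b2z (~~ b)).
Proof.
move=> w0 ev; rewrite -b2z_eq0.
exact: (eval_bin ev (eval_cst _ (is_word_b2z false w0)) _ (is_word_b2z _ w0)).
Qed.

Lemma eval_ltb w st e1 e2 x1 x2 : (0 < w)%N ->
  eval w st e1 = Some x1 -> eval w st e2 = Some x2 ->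
  eval w st (Bin Ltb e1 e2) = Some (b2z (x1 < x2)).
Proof. by move=> w0 ev1 ev2; exact: (eval_bin ev1 ev2 _ (is_word_b2z _ w0)). Qed.

Lemma eval_eqb w st e1 e2 x1 x2 : (0 < w)%N ->
  eval w st e1 = Some x1 -> eval w st e2 = Some x2 ->
  eval w st (Bin Eqb e1 e2) = Some (b2z (x1 == x2)).
Proof. by move=> w0 ev1 ev2; exact: (eval_bin ev1 ev2 _ (is_word_b2z _ w0)). Qed.

Lemma eval_mulb w st e1 e2 b1 b2 : (0 < w)%N ->
  eval w st e1 = Some (b2z b1) -> eval w st e2 = Some (b2z b2) ->
  eval w st (Bin Mul e1 e2) = Some (b2z (b1 && b2)).
Proof.
by move=> w0 ev1 ev2; exact: (eval_bin (o := Mul) ev1 ev2 (b2zM _ _) (is_word_b2z _ w0)).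
Qed.

(** * Entrywise checks *)

(** Since [j < n], the pair is the quotient and remainder of the index by [n], so [pick] has a
    single candidate. *)
Lemma rowmajorE n (A : 'M[int]_n) (i j : 'I_n) :
  rowmajor A (i * n + j)%N%:Z = A i j.
Proof.
rewrite /rowmajor; case: pickP => [[i' j'] /= /eqP [E]|/(_ (i, j))]; last by rewrite eqxx.
have n0 : (0 < n)%N := leq_ltn_trans (leq0n _) (ltn_ord i).
have Ei : i = i'.
  by apply/val_inj; have := congr1 (divn^~ n) E; rewrite !divnMDl // !divn_small ?addn0.
have Ej : j = j' by apply/val_inj; have := E; rewrite Ei => /addnI.
by rewrite Ei Ej.
Qed.

Lemma rowmajor0 n k : rowmajor (0 : 'M[int]_n) k = 0.
Proof. by rewrite /rowmajor; case: pickP => // p _; rewrite mxE. Qed.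

Lemma rowmajor_word w n (A : 'M[int]_n) k : mx_words w A -> is_word w (rowmajor A k).
Proof.
move=> wA; rewrite /rowmajor; case: pickP => // _.
by rewrite /is_word absz0 expn_gt0.
Qed.

Lemma all_entries n (f : nat -> bool) :
  all f (iota 0 (n * n)) <-> forall i j : 'I_n, f (i * n + j)%N.
Proof.
split=> [/allP fP i j|fP].
  apply: fP; rewrite mem_iota /= add0n; apply: (@leq_trans (i.+1 * n)).
    by rewrite mulSn addnC ltn_add2r.
  by rewrite leq_mul2r (ltn_ord i) orbT.
apply/allP => k; rewrite mem_iota /= add0n => kn.
have n0 : (0 < n)%N by case: n kn {fP} => //; rewrite muln0.
have i_n : (k %/ n < n)%N by rewrite ltn_divLR.
have j_n : (k %% n < n)%N by rewrite ltn_mod.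
by rewrite (divn_eq k n); apply: (fP (Ordinal i_n) (Ordinal j_n)).
Qed.

(** The list that [separator_input] loads, so positions are array numbers: 0 to 3 for the adjacency
    matrices of [LRound], [LSquare], [RRound], [RSquare], then 4 to 9 for [mS], [mSS], [mRS], [mQS],
    [mRSR], [mQSQ]. *)
Definition input_mxs n (G : instance n) (M : sextuple n) : seq 'M[int]_n :=
  [:: adj G LRound; adj G LSquare; adj G RRound; adj G RSquare] ++ sextuple_seq M.

Definition input_mx n (G : instance n) (M : sextuple n) (a : nat) : 'M[int]_n :=
  nth 0 (input_mxs G M) a.

Definition ready n (G : instance n) (M : sextuple n) (st : state) : Prop :=
  [/\ regs st 0 = n%:Z, regs st 1 = (source G : nat)%:Z,
      regs st 2 = (target G : nat)%:Z &
      forall a, (a < 10)%N -> store st a = rowmajor (input_mx G M a)].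

(** The memory convention of all programs below: registers 0 to 2 and arrays 0 to 9 hold the input,
    anything above is scratch space. *)
Lemma ready_frame n (G : instance n) (M : sextuple n) R A st st' :
  all (leq 3) R -> all (leq 10) A -> frame R A st st' -> ready G M st -> ready G M st'.
Proof.
move=> /allP R3 /allP A10 [fr fa _] [r0 r1 r2 ra].
have reg r : (r < 3)%N -> regs st' r = regs st r.
  by move=> r3; apply: fr; apply/negP => /R3; lia.
split; rewrite ?reg // => a a10; rewrite fa ?ra //.
by apply/negP => /A10; lia.
Qed.

(* Numbers of the input arrays X, Y, Z of the conditions X *m Y = Z. *)
Definition products : seq (nat * nat * nat) :=
  [:: (0, 4, 6); (1, 4, 7); (4, 4, 5); (6, 2, 8); (7, 3, 9)]%N.

Definition product_ok n (G : instance n) (M : sextuple n) (p : nat * nat * nat) : bool :=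
  let: (x, y, z) := p in input_mx G M x *m input_mx G M y == input_mx G M z.

(** Worded after the machine expression [entry_check]: the machine has only strict comparison and
    equality, hence the negations, and the diagonal is recognised by quotient and remainder of [k].
    The condition at (s, t) is retested with every entry, at constant cost, so that a single loop
    covers all conditions. *)
Definition entry_ok n (G : instance n) (M : sextuple n) (k : nat) : bool :=
  let N a := rowmajor (input_mx G M a) k%:Z in
  [&& all (fun a => ~~ (N a < 0) && ~~ ((n * n)%N%:Z < N a)) (iota 4 6),
      N 4%N < 2, ~~ ((k %/ n == k %% n)%N && (N 4%N == 0)),
      all (fun a => ~~ ((N a != 0) && (N 4%N == 0))) [:: 5; 8; 9]%N &
      input_mx G M 4 (source G) (target G) == 0].

Definition entries_ok n (G : instance n) (M : sextuple n) : bool :=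
  all (entry_ok G M) (iota 0 (n * n)).

Definition entry_spec n (G : instance n) (M : sextuple n) (i j : 'I_n) : bool :=
  [&& all (fun a => 0 <= input_mx G M a i j <= (n * n)%N%:Z) (iota 4 6),
      mS M i j < 2, (i == j) ==> (mS M i j != 0),
      all (fun a => (input_mx G M a i j != 0) ==> (mS M i j != 0)) [:: 5; 8; 9]%N &
      mS M (source G) (target G) == 0].

Lemma entries_okP n (G : instance n) (M : sextuple n) :
  entries_ok G M <->
  forall i j, entry_spec G M i j.
Proof.
have n0 : (0 < n)%N := leq_ltn_trans (leq0n _) (ltn_ord (source G)).
suff E (i j : 'I_n) : entry_ok G M (i * n + j) =
  entry_spec G M i j.
  by rewrite /entries_ok all_entries; split=> H i j; have := H i j; rewrite E.
rewrite /entry_spec /entry_ok /= !rowmajorE -!leNgt.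
rewrite divnMDl // divn_small // addn0 modnMDl modn_small // val_eqE.
by rewrite !negb_and !implybE !negbK.
Qed.

Lemma input_mx_range n (G : instance n) (M : sextuple n) a i j :
  entries_ok G M -> 0 <= input_mx G M a i j <= (n ^ 2)%N%:Z.
Proof.
move=> /entries_okP /(_ i j) /and5P[/allP rg _ _ _ _]; rewrite -mulnn.
have n0 : (0 < n)%N := leq_ltn_trans (leq0n _) (ltn_ord (source G)).
have adjr b : 0 <= adj G b i j <= (n * n)%N%:Z.
  by have /andP[-> /le_trans->] := adj_range G b i j; rewrite // lez_nat muln_gt0 n0.
have [a4|a4] := ltnP a 4; first by case: a a4 => [|[|[|[|]]]] // _; apply: adjr.
have [a10|a10] := ltnP a 10; first by apply: rg; rewrite mem_iota a4.
by rewrite /input_mx nth_default // mxE lexx.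
Qed.

Lemma input_mx_words w n (G : instance n) (M : sextuple n) a : (0 < w)%N ->
  sextuple_words w M -> mx_words w (input_mx G M a).
Proof.
move=> w0 wM; have [a4|a4] := ltnP a 4.
  have adjw b : mx_words w (adj G b) by move=> i j; rewrite mxE is_word_b2z.
  by case: a a4 => [|[|[|[|]]]] // _; apply: adjw.
have [a10|a10] := ltnP a 10; last first.
  by move=> i j; rewrite /input_mx nth_default // mxE /is_word absz0 expn_gt0.
apply: wM; rewrite -[sextuple_seq M]/(drop 4 (input_mxs G M)).
rewrite /input_mx -{1}(subnKC a4) -nth_drop; apply: mem_nth.
by rewrite /= ltn_subLR.
Qed.

(** Once the entries of [mS] are 0 or 1, the inequality between [boolmx K] and [mS] says that [mS]
    is nonzero wherever [K] is; this is the form that the entrywise check tests. *)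
Lemma separatorP n (G : instance n) (M : sextuple n) :
  separator G M <-> entries_ok G M && all (product_ok G M) products.
Proof.
split=> [sep|/andP[/entries_okP eok]]; last first.
  rewrite /products /= => /and5P[/eqP p1 /eqP p2 /eqP p3 /eqP p4 /andP[/eqP p5 _]].
  have S01 i j : mS M i j = 0 \/ mS M i j = 1.
    have /and5P[/andP[/andP[S0 _] _] S2 _ _ _] := eok i j.
    by move: S0 S2; rewrite /input_mx /=; lia.
  have leS (K : 'M[int]_n) : (forall i j, (K i j != 0) ==> (mS M i j != 0)) ->
      lemx (boolmx K) (mS M).
    move=> le i j; rewrite mxE; have := le i j.
    by case: (K i j != 0); case: (S01 i j) => -> //=; rewrite eqxx.
  split=> //.
  - move=> N HN i j; have [a a6 <-] := nthP 0 HN.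
    have /and5P[/allP rg _ _ _ _] := eok i j.
    have := rg (4 + a)%N; rewrite mem_iota ltn_add2l leq_addr /= mulnn; apply.
    exact: a6.
  - move=> i j; have /and5P[_ _ /implyP dg _ _] := eok i j; rewrite mxE.
    have {dg} : i == j -> mS M i j != 0 by [].
    case: (i == j) => [/(_ isT)|_]; last by case: (S01 i j) => ->.
    by case: (S01 i j) => ->.
  - by apply: leS => i j; have /and5P[_ _ _ /and3P[-> _ _] _] := eok i j.
  - by apply: leS => i j; have /and5P[_ _ _ /and3P[_ H _] _] := eok i j.
  - by apply: leS => i j; have /and5P[_ _ _ /and4P[_ _ H _] _] := eok i j.
  - by have /and5P[_ _ _ _ /eqP] := eok (source G) (target G).
apply/andP; split; last first.
  rewrite /products /= /input_mx /=.
  by rewrite (sep_LRound sep) (sep_LSquare sep) (sep_SS sep) (sep_RRound sep)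
    (sep_RSquare sep) !eqxx.
apply/entries_okP => i j.
have S01 := sep_range01 sep.
have leS (K : 'M[int]_n) : lemx (boolmx K) (mS M) ->
    (K i j != 0) ==> (mS M i j != 0).
  move=> le; apply/implyP => K0; have := le i j; rewrite mxE K0 /=.
  by case: (S01 i j) => ->.
apply/and5P; split.
- apply/allP => a; rewrite mem_iota => /andP[a4 a10]; rewrite mulnn.
  apply: (sep_range sep); rewrite -[sextuple_seq M]/(drop 4 (input_mxs G M)).
  rewrite /input_mx -{1}(subnKC a4) -nth_drop; apply: mem_nth.
  by rewrite /= ltn_subLR.
- by rewrite /=; case: (S01 i j) => ->.
- apply/implyP => /eqP Eij; have := sep_id sep i j.
  rewrite Eij mxE eqxx /=.
  by case: (S01 j j) => ->.
- rewrite /= (leS _ (sep_le_SS sep)) (leS _ (sep_le_round sep)).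
  by rewrite (leS _ (sep_le_square sep)).
- by rewrite (sep_st sep).
Qed.

Definition cell (a : nat) : expr := Read a (Reg 4).

Definition Area : expr := Bin Mul (Reg 0) (Reg 0).

Definition entry_check : expr :=
  Bin Mul (Conj [seq Bin Mul (Not (Bin Ltb (cell a) (Cst 0)))
                             (Not (Bin Ltb Area (cell a))) | a <- iota 4 6])
  (Bin Mul (Bin Ltb (cell 4) (Cst 2))
  (Bin Mul (Not (Bin Mul (Bin Eqb (Bin Div (Reg 4) (Reg 0)) (Bin Mod (Reg 4) (Reg 0)))
                         (Not (cell 4))))
  (Bin Mul (Conj [seq Not (Bin Mul (Not (Not (cell a))) (Not (cell 4)))
                 | a <- [:: 5; 8; 9]%N])
           (Not (Read 4 (Bin Add (Bin Mul (Reg 1) (Reg 0)) (Reg 2))))))).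

(* The programs compute values of size at most n ^ 7, from entries in [0, n ^ 2]. *)
Definition wide (w n : nat) : Prop := (n.+1 ^ 8 <= 2 ^ w)%N.

Lemma wide_gt0 w n : (0 < n)%N -> wide w n -> (1 < w)%N.
Proof.
move=> n0 ww; have : (2 ^ 8 <= 2 ^ w)%N by apply: leq_trans ww; rewrite leq_exp2r.
by rewrite leq_exp2l // => /(leq_trans _); apply.
Qed.

Lemma wide_nat w n m : (0 < n)%N -> wide w n -> (m <= n.+1 ^ 7)%N -> (m < 2 ^ w)%N.
Proof.
move=> n0 ww le; apply: leq_trans ww; apply: leq_ltn_trans le _.
by rewrite ltn_exp2l.
Qed.

Lemma wide_exp w n m k : (0 < n)%N -> wide w n -> (k <= 7)%N -> (m <= n ^ k)%N ->
  (m < 2 ^ w)%N.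
Proof.
move=> n0 ww k7 le; apply: (wide_nat n0 ww); apply: leq_trans le _.
by apply: (@leq_trans (n.+1 ^ k)); [case: k k7 => // k _; rewrite leq_exp2r | rewrite leq_exp2l].
Qed.

(** Since [n < 2 ^ (trunc_log 2 n).+1], each of the [d] copies of the logarithm contributes a factor
    of at least [n.+1]; eight of them give [wide]. *)
Lemma wide_wordsize d n : (8 <= d)%N -> wide (wordsize d n) n.
Proof.
move=> d8; rewrite /wide /wordsize mulnC expnM; apply: (@leq_trans (n.+1 ^ d)).
  by rewrite leq_pexp2l.
case: d d8 => // d _; rewrite leq_exp2r //; exact: trunc_log_ltn.
Qed.

(** The entries are only known to be words here, so they are compared but never added or multiplied.
    Arithmetic is confined to indices, to [n * n] and to 0-1 values, all of which fit. *)
Lemma eval_entry_check w n (G : instance n) (M : sextuple n) s k :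
    wide w n -> sextuple_words w M -> (k < n * n)%N ->
    ready G M s -> regs s 4 = k%:Z ->
  eval w s entry_check = Some (b2z (entry_ok G M k)).
Proof.
move=> ww wM kn [s0 s1 s2 sa] s4.
have n0 : (0 < n)%N := leq_ltn_trans (leq0n _) (ltn_ord (source G)).
have w1 := wide_gt0 n0 ww; have w0 := ltnW w1.
have nat_w e m : (e <= 7)%N -> (m <= n ^ e)%N -> is_word w m%:Z.
  by move=> e7 le; rewrite is_word_nat; apply: wide_exp n0 ww e7 le.
have nn : (n <= n * n)%N by rewrite leq_pmulr.
have e0 : eval w s (Reg 0) = Some n%:Z by apply: eval_reg => //; apply: (nat_w 1%N).
have e4 : eval w s (Reg 4) = Some k%:Z.
  by apply: eval_reg => //; apply: (nat_w 2%N) => //; rewrite -mulnn ltnW.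
have eA : eval w s Area = Some (n * n)%N%:Z.
  by apply: (eval_bin e0 e0); [rewrite /= PoszM | apply: (nat_w 2%N)].
have ecell a : (a < 10)%N -> eval w s (cell a) = Some (rowmajor (input_mx G M a) k).
  move=> a10; apply: eval_read e4 _ _; first by rewrite sa.
  by apply: rowmajor_word; apply: input_mx_words.
have enot e x : eval w s e = Some x -> eval w s (Not e) = Some (b2z (x == 0)).
  by move=> ev; apply: (eval_eqb w0 ev); apply: eval_cst; apply: (is_word_b2z false w0).
have enotb e b : eval w s e = Some (b2z b) -> eval w s (Not e) = Some (b2z (~~ b)).
  exact: eval_not.
have c0 : eval w s (Cst 0) = Some 0 by apply: eval_cst; apply: (is_word_b2z false w0).
have c2 : eval w s (Cst 2) = Some 2.
  by apply: eval_cst; rewrite (is_word_nat w 2) -[X in (X < _)%N](expn1 2) ltn_exp2l.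
rewrite /entry_check /entry_ok.
apply: eval_mulb => //.
  have : all (fun a => (a < 10)%N) (iota 4 6) by [].
  elim: (iota 4 6) => [_|a s' IH /andP[a10 /IH IH']].
    exact: (eval_cst _ (is_word_b2z true w0)).
  apply: (eval_mulb w0 _ IH'); apply: eval_mulb => //; apply: (enotb).
    exact: (eval_ltb w0 (ecell _ a10) c0).
  exact: (eval_ltb w0 eA (ecell _ a10)).
apply: eval_mulb => //; first exact: (eval_ltb w0 (ecell _ _) c2).
apply: eval_mulb => //.
  apply: (enotb); apply: eval_mulb => //; last by apply: (enot); apply: (ecell).
  rewrite -[(k %/ n == k %% n)%N]eqz_nat -modz_nat -divz_nat.
  apply: eval_eqb => //.
    apply: (eval_bin e4 e0) => //=; rewrite divz_nat; apply: (nat_w 2%N) => //.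
    by rewrite -mulnn (leq_trans (leq_div _ _)) // ltnW.
  apply: (eval_bin e4 e0) => //=; rewrite modz_nat; apply: (nat_w 1%N) => //.
  by rewrite expn1 ltnW // ltn_mod.
apply: eval_mulb => //.
  have : all (fun a => (a < 10)%N) [:: 5; 8; 9]%N by [].
  elim: [:: 5; 8; 9]%N => [_|a s' IH /andP[a10 /IH IH']].
    exact: (eval_cst _ (is_word_b2z true w0)).
  apply: (eval_mulb w0 _ IH'); apply: (enotb); apply: eval_mulb => //.
    by apply: (enotb); apply: (enot); apply: (ecell).
  by apply: (enot); apply: (ecell).
apply: (enot); rewrite -rowmajorE.
have stn : (source G * n + target G < n * n)%N.
  apply: (@leq_trans ((source G).+1 * n)); first by rewrite mulSn addnC ltn_add2r.
  by rewrite leq_mul2r (ltn_ord (source G)) orbT.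
apply: (eval_read (i := (source G * n + target G)%N%:Z)); first last.
- by apply: rowmajor_word; apply: input_mx_words.
- by rewrite sa.
have sn : (source G * n <= n * n)%N by rewrite leq_mul2r ltnW ?orbT.
have es : eval w s (Reg 1) = Some (source G : nat)%:Z.
  by apply: eval_reg => //; apply: (nat_w 1%N) => //; rewrite expn1 ltnW.
have et : eval w s (Reg 2) = Some (target G : nat)%:Z.
  by apply: eval_reg => //; apply: (nat_w 1%N) => //; rewrite expn1 ltnW.
have em : eval w s (Bin Mul (Reg 1) (Reg 0)) = Some (source G * n)%N%:Z.
  by apply: (eval_bin es e0); [rewrite /= PoszM | apply: (nat_w 2%N)].
apply: (eval_bin em et); first by rewrite /= PoszD.
by apply: (nat_w 2%N) => //; rewrite -mulnn ltnW.
Qed.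

(** The guard is needed for halting and not only for the verdict: with entries outside [0, n ^ 2]
    the body could overflow and get stuck. *)
Definition Decide (body : cmd) : cmd :=
  Seq (Assign 3 (Cst 1)) (Seq (AllLoop Area entry_check)
  (Seq (If (Reg 3) body Skip) (Assign 0 (Reg 3)))).

Lemma runs_decide w n (G : instance n) (M : sextuple n) body T (b : bool) st :
    wide w n -> sextuple_words w M -> ready G M st ->
    (forall s, entries_ok G M -> frame [:: 3; 4]%N [::] st s -> ready G M s ->
       regs s 3 = 1 -> runs w body s T (fun s' => regs s' 3 = b2z b)) ->
  runs w (Decide body) st (500 * n ^ 2 + T)
    (fun s => outputs s (entries_ok G M && b)).
Proof.
move=> ww wM rdy Hbody.
have n0 : (0 < n)%N := leq_ltn_trans (leq0n _) (ltn_ord (source G)).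
have w1 := wide_gt0 n0 ww; have w0 := ltnW w1.
apply: (@runs_weaken _ _ _
  (2 + (n * n * (cost entry_check + 3 + 13) + 13 + ((1 + T.+1).+1 + 2)))%N _
  (fun s => outputs s (entries_ok G M && b))).
(* The check is a closed expression, so its cost is a constant found by computation; [n * n >= 1]
   absorbs the additive terms. *)
- have : (cost entry_check <= 200)%N by [].
  have := muln_gt0 n n; rewrite n0 /= => n2; rewrite -mulnn.
  by move: (n * n)%N n2 => m m0; nia.
- by [].
apply: runs_seq; apply: runs_assign; first exact: (eval_cst _ (is_word_b2z true w0)).
set st1 := set_reg _ _ _.
have fr1 : frame [:: 3; 4]%N [::] st st1 by apply: frame_set_reg.
have rdy_fr s : frame [:: 3; 4]%N [::] st s -> ready G M s.
  by move=> fr; apply: ready_frame fr rdy.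
have reg0w s : ready G M s -> eval w s (Reg 0) = Some n%:Z.
  by case=> s0 _ _ _; apply: eval_reg => //; apply: (wide_exp (k := 1) n0 ww).
apply: runs_seq; apply: runs_weaken (leqnn _) _
  (@runs_all w st1 Area entry_check (n * n)%N true (entry_ok G M) w0 _ _ _ _) => //.
- move=> s [fr s3]; have {fr}fr := frame_trans fr1 fr; have rs := rdy_fr _ fr.
  apply: runs_seq; apply: (runs_if (b := entries_ok G M)).
    by apply: eval_reg s3 (is_word_b2z _ w0).
  case: ifP => ok.
    apply: runs_weaken (Hbody s ok fr rs _) => //; last by rewrite s3 -/(entries_ok _ _) ok.
    move=> s' s'3; apply: (@runs_assign _ _ _ (Reg 3) (b2z b)) => //.
    by apply: eval_reg s'3 (is_word_b2z _ w0).
  apply: (@runs_weaken _ _ _ 1) => //; last apply: runs_skip.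
    exact: (fun _ => id).
  apply: (@runs_assign _ _ _ (Reg 3) 0) => //.
  apply: eval_reg (is_word_b2z false w0).
  by rewrite s3 -/(entries_ok _ _) ok.
- by apply: (wide_exp (k := 2) n0 ww).
- move=> s fr; have rs := rdy_fr _ (frame_trans fr1 fr).
  apply: (eval_bin (reg0w _ rs) (reg0w _ rs)); first by rewrite /= PoszM.
  by apply: (wide_exp (k := 2) n0 ww).
- move=> k s kn fr s4.
  by apply: eval_entry_check => //; apply: rdy_fr (frame_trans fr1 fr).
Qed.

(** * Freivalds' test *)

Definition MatVec (a v out : nat) : cmd :=
  For 4 (Reg 0) (Seq (Assign 6 (Cst 0)) (Seq
    (For 5 (Reg 0) (Assign 6 (Bin Add (Reg 6)
       (Bin Mul (Read a (Bin Add (Bin Mul (Reg 4) (Reg 0)) (Reg 5))) (Read v (Reg 5))))))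
    (Write out (Reg 4) (Reg 6)))).

Lemma sum_range (g : nat -> int) k n b :
  (k <= n)%N -> (forall j, (j < n)%N -> 0 <= g j <= b%:Z) ->
  0 <= \sum_(0 <= j < k) g j <= (n * b)%N%:Z.
Proof.
move=> kn gb; suff /andP[-> /le_trans->//] : 0 <= \sum_(0 <= j < k) g j <= (k * b)%N%:Z.
  by rewrite lez_nat leq_mul2r kn orbT.
elim: k kn => [|k IHk] kn; first by rewrite big_geq.
have := IHk (ltnW kn); have := gb _ kn; rewrite big_nat_recr //= mulSn PoszD.
by move: (g k) (\sum_(_ <= _ < _) _) (k * b)%N => x y z; lia.
Qed.

(** A partial sum has at most [n] terms, each between 0 and [n ^ 2 * B], so it is at most
    [n ^ 3 * B]. The bound [B] is a parameter because the vector is once the 0-1 vector u and once Y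
    u. *)
Lemma runs_matvec w n a v out (B : nat) st :
    (0 < n)%N -> wide w n -> a != out -> v != out ->
    regs st 0 = n%:Z ->
    (forall i j, (i < n)%N -> (j < n)%N -> 0 <= store st a (i * n + j)%N%:Z <= (n ^ 2)%N%:Z) ->
    (forall j, (j < n)%N -> 0 <= store st v j%:Z <= B%:Z) ->
    (n ^ 3 * B <= n ^ 7)%N ->
  runs w (MatVec a v out) st (70 * n ^ 2)
    (fun s => frame [:: 4; 5; 6]%N [:: out] st s /\
       forall i, (i < n)%N -> store s out i%:Z =
         \sum_(0 <= j < n) store st a (i * n + j)%N%:Z * store st v j%:Z).
Proof.
move=> n0 ww aout vout st0 Ab Vb nB.
have w0 : (0 < w)%N := ltnW (wide_gt0 n0 ww).
have nat_w e m : (e <= 7)%N -> (m <= n ^ e)%N -> is_word w m%:Z.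
  by move=> e7 le; rewrite is_word_nat; apply: wide_exp n0 ww e7 le.
have int_w (x : int) : 0 <= x <= (n ^ 3 * B)%N%:Z -> is_word w x.
  by move=> /is_word_le; apply; apply: (nat_w 7%N).
pose g i j := store st a (i * n + j)%N%:Z * store st v j%:Z.
have gb i j : (i < n)%N -> (j < n)%N -> 0 <= g i j <= (n ^ 2 * B)%N%:Z.
  move=> i_n j_n; case/andP: (Ab i j i_n j_n) (Vb j j_n) => ? ? /andP[? ?].
  by rewrite /g mulr_ge0 //= PoszM ler_pM.
have sb i k : (i < n)%N -> (k <= n)%N -> 0 <= \sum_(0 <= j < k) g i j <= (n ^ 3 * B)%N%:Z.
  by move=> i_n k_n; rewrite expnS -mulnA; apply: sum_range => // j; apply: gb.
have n3 m : (m <= B)%N -> (m <= n ^ 3 * B)%N.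
  by move=> /leq_trans; apply; rewrite leq_pmull // expn_gt0 n0.
have n2 m : (m <= n ^ 2 * B)%N -> (m <= n ^ 3 * B)%N.
  by move=> /leq_trans; apply; rewrite leq_mul2r leq_pexp2l // orbT.
pose fr := frame [:: 4; 5; 6]%N [:: out] st.
pose row i s := forall i', (i' < i)%N -> store s out i'%:Z = \sum_(0 <= j < n) g i' j.
pose Inv i s := [/\ fr s, regs s 4 = i%:Z & row i s].
have e0 s : fr s -> eval w s (Reg 0) = Some n%:Z.
  by case=> rs _ _; apply: eval_reg (nat_w 1%N _ _ _); rewrite // rs.
(* The inner assignment takes 12 steps and [Reg 0] costs 1; the sum is
   [23 * n ^ 2 + 27 * n + 11]. *)
apply: (@runs_weaken _ _ _
  (n * ((2 + ((n * (12 + 1 + 10) + (1 + 10)) + 3)) + 1 + 10) + (1 + 10))%N _ (Inv n)).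
- by rewrite -mulnn; nia.
- by move=> s [].
apply: runs_for => //; first by apply: (wide_exp (k := 1) n0 ww).
- by move=> i s i_n [frs s4 _]; split=> //; apply: e0.
- by split=> //; apply: frame_set_reg.
move=> i s i_n [frs s4 rows].
apply: runs_seq; apply: runs_assign; first exact: (eval_cst _ (is_word_b2z false w0)).
apply: runs_seq.
pose Inv2 k s := [/\ fr s, regs s 4 = i%:Z /\ regs s 5 = k%:Z, row i s
  & regs s 6 = \sum_(0 <= j < k) g i j].
apply: (@runs_weaken _ _ _ (n * (12 + 1 + 10) + (1 + 10))%N _ (Inv2 n)) => //.
- move=> s' [frs' [s'4 s'5] rows' s'6]; apply: runs_write.
  + by apply: eval_reg s'4 (nat_w 1%N _ _ _) => //; rewrite expn1 ltnW.
  + by apply: eval_reg s'6 _; apply/int_w/sb.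
  split=> //; split=> //.
    by apply: frame_set_reg => //; apply: frame_set_mem => //; rewrite mem_head.
  move=> i'; rewrite ltnS leq_eqVlt /= eqxx /= eqz_nat.
  by case: eqVneq => [-> _ //|_ /=]; apply: rows'.
apply: runs_for => //; first by apply: (wide_exp (k := 1) n0 ww).
- by move=> k s' k_n [frs' [_ s'5] _ _]; split=> //; apply: e0.
- split=> //; first by do 2![apply: frame_set_reg => //].
  by rewrite /= big_geq.
move=> k s' k_n [frs' [s'4 s'5] rows' s'6].
have [rs' ss' _] := frs'.
have ik_n : (i * n + k <= n ^ 2)%N.
  rewrite -mulnn ltnW //; apply: (@leq_trans (i.+1 * n)).
    by rewrite mulSn addnC ltn_add2r.
  by rewrite leq_mul2r i_n orbT.
have e4 : eval w s' (Reg 4) = Some i%:Z.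
  by apply: eval_reg s'4 (nat_w 1%N _ _ _) => //; rewrite expn1 ltnW.
have e5 : eval w s' (Reg 5) = Some k%:Z.
  by apply: eval_reg s'5 (nat_w 1%N _ _ _) => //; rewrite expn1 ltnW.
have ein : eval w s' (Bin Mul (Reg 4) (Reg 0)) = Some (i * n)%N%:Z.
  apply: (eval_bin e4 (e0 _ frs')); first by rewrite /= PoszM.
  by apply: (nat_w 2%N) => //; apply: leq_trans ik_n; apply: leq_addr.
have eik : eval w s' (Bin Add (Bin Mul (Reg 4) (Reg 0)) (Reg 5)) = Some (i * n + k)%N%:Z.
  by apply: (eval_bin ein e5); [rewrite /= PoszD | apply: (nat_w 2%N)].
have eA : eval w s' (Read a (Bin Add (Bin Mul (Reg 4) (Reg 0)) (Reg 5)))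
    = Some (store st a (i * n + k)%N%:Z).
  apply: eval_read eik _ _; first by rewrite ss' // inE.
  by apply: is_word_le (Ab i k i_n k_n) _; apply: (nat_w 2%N).
have eV : eval w s' (Read v (Reg 5)) = Some (store st v k%:Z).
  apply: eval_read e5 _ _; first by rewrite ss' // inE.
  by apply: is_word_le (Vb k k_n) _; apply: (nat_w 7%N) => //; apply: leq_trans nB; apply: n3.
apply: (@runs_assign _ _ _ (Bin Add (Reg 6)
       (Bin Mul (Read a (Bin Add (Bin Mul (Reg 4) (Reg 0)) (Reg 5))) (Read v (Reg 5))))
  (\sum_(0 <= j < k.+1) g i j)).
  apply: (eval_bin (o := Add) (x1 := \sum_(0 <= j < k) g i j) (x2 := g i k)).
  - by apply: eval_reg s'6 _; apply/int_w/sb => //; apply: ltnW.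
  - apply: (eval_bin eA eV) => //; apply: is_word_le (gb i k i_n k_n) _.
    by apply: (nat_w 7%N) => //; apply: leq_trans nB; apply: n2.
  - by rewrite /= [RHS]big_nat_recr.
  - by apply/int_w/sb.
by split=> //; split=> //; do 2![apply: frame_set_reg => //].
Qed.

Definition coin_col n (cs : seq bool) : 'cV[int]_n := \col_i b2z (nth false cs i).

Definition Sample : cmd := For 4 (Reg 0) (Seq (Flip 5) (Write 10 (Reg 4) (Reg 5))).

(** A frame fixes the coins, and sampling consumes some; the frame is therefore taken relative to
    the initial state with its coins replaced by the remaining ones. *)
Lemma runs_sample w n st :
    (0 < n)%N -> wide w n -> regs st 0 = n%:Z -> (n <= size (coins st))%N ->
  runs w Sample st (40 * n ^ 2)
    (fun s => (exists c, frame [:: 4; 5]%N [:: 10]%N (State (regs st) (store st) c) s) /\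
       forall i, (i < n)%N -> store s 10 i%:Z = b2z (nth false (coins st) i)).
Proof.
move=> n0 ww st0 nc.
have w0 : (0 < w)%N := ltnW (wide_gt0 n0 ww).
have nw m : (m <= n)%N -> is_word w m%:Z.
  by move=> le; rewrite is_word_nat; apply: (wide_exp (k := 1) n0 ww).
pose st' i := State (regs st) (store st) (drop i (coins st)).
pose Inv i s := [/\ frame [:: 4; 5]%N [:: 10]%N (st' i) s, regs s 4 = i%:Z &
   forall i', (i' < i)%N -> store s 10 i'%:Z = b2z (nth false (coins st) i')].
apply: (@runs_weaken _ _ _ (n * ((1 + 3) + 1 + 10) + (1 + 10))%N _ (Inv n)).
- by rewrite -mulnn; nia.
- by move=> s [frs _ Is]; split=> //; exists (drop n (coins st)).
apply: runs_for => //; first exact: nw.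
- by move=> i s i_n [[rs _ _] s4 _]; split=> //; apply: eval_reg (nw _ _); rewrite ?rs.
- by split=> //; apply: frame_set_reg => //; rewrite /st' drop0; case: (st).
move=> i s i_n [[rs ss cs] s4 Is].
apply: runs_seq; apply: (@runs_flip _ _ _ (nth false (coins st) i) (drop i.+1 (coins st))).
  by rewrite cs -drop_nth // (leq_trans i_n).
apply: (@runs_write _ _ _ _ _ i%:Z (b2z (nth false (coins st) i))).
- by apply: eval_reg s4 (nw _ _); apply: ltnW.
- by apply: eval_reg (is_word_b2z _ w0).
split=> //; split=> //.
  apply: frame_set_reg => //; apply: frame_set_mem => //; apply: frame_set_reg => //.
move=> i'; rewrite ltnS leq_eqVlt /= eqz_nat.
by case: eqVneq => [-> _ //|_ /=]; apply: Is.
Qed.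

Definition freivalds_ok n (G : instance n) (M : sextuple n) (u : 'cV[int]_n)
    (p : nat * nat * nat) : bool :=
  let: (x, y, z) := p in
  input_mx G M x *m (input_mx G M y *m u) == input_mx G M z *m u.

Definition FreivaldsTest (p : nat * nat * nat) : cmd :=
  let: (x, y, z) := p in
  Seq (MatVec y 10 11) (Seq (MatVec x 11 12) (Seq (MatVec z 10 13)
    (AllLoop (Reg 0) (Bin Eqb (Read 12 (Reg 4)) (Read 13 (Reg 4)))))).

(** Array 10 holds u, and arrays 11, 12, 13 receive Y u, X (Y u) and Z u. With u a 0-1 vector and
    matrix entries at most [n ^ 2], these are bounded by [n ^ 3], [n ^ 6] and [n ^ 3]. *)
Lemma runs_freivalds w n (G : instance n) (M : sextuple n) cs x y z (b : bool) st :
    wide w n -> ready G M st -> entries_ok G M ->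
    [&& x < 10, y < 10 & z < 10]%N -> regs st 3 = b2z b ->
    (forall i, (i < n)%N -> store st 10 i%:Z = b2z (nth false cs i)) ->
  runs w (FreivaldsTest (x, y, z)) st (250 * n ^ 2)
    (fun s => frame [:: 3; 4; 5; 6]%N [:: 11; 12; 13]%N st s /\
      regs s 3 = b2z (b && freivalds_ok G M (coin_col n cs) (x, y, z))).
Proof.
move=> ww rdy ok /and3P[x10 y10 z10] st3 stc.
have n0 : (0 < n)%N := leq_ltn_trans (leq0n _) (ltn_ord (source G)).
have w0 : (0 < w)%N := ltnW (wide_gt0 n0 ww).
have rdy_fr s : frame [:: 3; 4; 5; 6]%N [:: 11; 12; 13]%N st s -> ready G M s.
  by move=> fr; apply: ready_frame fr rdy.
have entry s a : ready G M s -> (a < 10)%N -> forall i j (i_n : (i < n)%N) (j_n : (j < n)%N),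
    store s a (i * n + j)%N%:Z = input_mx G M a (Ordinal i_n) (Ordinal j_n).
  by move=> [_ _ _ sa] a10 i j i_n j_n; rewrite sa // -rowmajorE.
have range s a : ready G M s -> (a < 10)%N -> forall i j, (i < n)%N -> (j < n)%N ->
    0 <= store s a (i * n + j)%N%:Z <= (n ^ 2)%N%:Z.
  by move=> rs a10 i j i_n j_n; rewrite entry //; apply: input_mx_range.
have prod s a (u : 'cV[int]_n) (f : nat -> int) : ready G M s -> (a < 10)%N ->
    (forall j : 'I_n, f j = u j 0) -> forall i : 'I_n,
    \sum_(0 <= j < n) store s a (i * n + j)%N%:Z * f j = (input_mx G M a *m u) i 0.
  move=> rs a10 fu i; rewrite big_mkord mxE; apply: eq_bigr => j _.
  rewrite fu (entry s a rs a10 i j (ltn_ord i) (ltn_ord j)).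
  by congr (input_mx _ _ _ _ _ * _); apply: val_inj.
pose u := coin_col n cs.
have ub i : (i < n)%N -> 0 <= store st 10 i%:Z <= 1%N%:Z.
  by move=> i_n; rewrite stc // b2z_ge0 b2z_le1.
have leX e : (e <= 7)%N -> (n ^ e <= n ^ 7)%N by move=> e7; rewrite leq_pexp2l.
have subk k s s' : k \in [:: 11; 12; 13]%N ->
    frame [:: 4; 5; 6]%N [:: k] s s' -> frame [:: 3; 4; 5; 6]%N [:: 11; 12; 13]%N s s'.
  move=> kin; apply: frame_sub => l; last by rewrite inE => /eqP->.
  by rewrite !inE => ->; rewrite orbT.
have sub4 s s' : frame [:: 3; 4]%N [::] s s' -> frame [:: 3; 4; 5; 6]%N [:: 11; 12; 13]%N s s'.
  by apply: frame_sub => k; rewrite !inE // => /orP[] ->; rewrite ?orbT.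
have reg0 s : ready G M s -> regs s 0 = n%:Z by case.
apply: (@runs_weaken _ _ _
  (70 * n ^ 2 + (70 * n ^ 2 + (70 * n ^ 2 + (n * (5 + 1 + 13) + (1 + 10)))))%N
  _ _ _ _ (fun _ => id)).
  by rewrite -mulnn; nia.
apply: runs_seq; apply: runs_weaken (leqnn _) _
  (runs_matvec n0 ww (a := y) (v := 10%N) (out := 11%N) (B := 1%N) _ _
     (reg0 _ rdy) (range _ _ rdy y10) ub _) => //; last 2 first.
- by apply: contraTneq y10 => ->.
- by rewrite muln1 leX.
move=> s1 [/[dup] fr1 /(subk 11%N _ _ isT) fr1' E1].
have rdy1 := rdy_fr _ fr1'.
have Yu (i : 'I_n) : store s1 11 (i : nat)%:Z = (input_mx G M y *m u) i 0.
  by rewrite E1 //; apply: prod => // j; rewrite stc // mxE.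
have Yub i : (i < n)%N -> 0 <= store s1 11 i%:Z <= (n * n ^ 2)%N%:Z.
  move=> i_n; rewrite E1 //; apply: sum_range => // j j_n.
  have /andP[? ?] := range _ _ rdy y10 i j i_n j_n; have /andP[? ?] := ub _ j_n.
  by rewrite mulr_ge0 //= -(muln1 (n ^ 2)%N) PoszM ler_pM.
apply: runs_seq; apply: runs_weaken (leqnn _) _
  (runs_matvec n0 ww (a := x) (v := 11%N) (out := 12%N) _ _
     (reg0 _ rdy1) (range _ _ rdy1 x10) Yub _) => //; last 2 first.
- by apply: contraTneq x10 => ->.
- by rewrite -expnS -expnD leX.
move=> s2 [/[dup] fr2 /(subk 12%N _ _ isT) fr2' E2].
have fr2'' := frame_trans fr1' fr2'.
have rdy2 := rdy_fr _ fr2''.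
have XYu (i : 'I_n) : store s2 12 (i : nat)%:Z = (input_mx G M x *m (input_mx G M y *m u)) i 0.
  by rewrite E2 //; apply: prod => // j; rewrite Yu.
have XYub (i : nat) : (i < n)%N -> is_word w (store s2 12 i%:Z).
  move=> i_n; apply: (@is_word_le _ _ (n * (n ^ 2 * n ^ 3))%N%:Z).
    rewrite E2 //; apply: sum_range => // j j_n.
    have /andP[? ?] := range _ _ rdy1 x10 i j i_n j_n; have /andP[? ?] := Yub _ j_n.
    by rewrite mulr_ge0 //= PoszM ler_pM // expnS.
  by rewrite is_word_nat -expnD -expnS; apply: (wide_exp (k := 6) n0 ww).
have s2c (i : nat) : store s2 10 i%:Z = store st 10 i%:Z by case: fr2'' => _ ->.
apply: runs_seq; apply: runs_weaken (leqnn _) _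
  (runs_matvec n0 ww (a := z) (v := 10%N) (out := 13%N) (B := 1%N) _ _
     (reg0 _ rdy2) (range _ _ rdy2 z10) _ _) => //; last 3 first.
- by apply: contraTneq z10 => ->.
- by move=> j j_n; rewrite s2c ub.
- by rewrite muln1 leX.
move=> s3 [/[dup] fr3 /(subk 13%N _ _ isT) fr3' E3].
have fr3'' := frame_trans fr2'' fr3'.
have rdy3 := rdy_fr _ fr3''.
have Zu (i : 'I_n) : store s3 13 (i : nat)%:Z = (input_mx G M z *m u) i 0.
  by rewrite E3 //; apply: prod => // j; rewrite s2c stc // mxE.
have Zub (i : nat) : (i < n)%N -> is_word w (store s3 13 i%:Z).
  move=> i_n; apply: (@is_word_le _ _ (n * n ^ 2)%N%:Z).
    rewrite E3 //; apply: sum_range => // j j_n.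
    have /andP[? ?] := range _ _ rdy2 z10 i j i_n j_n; have := ub _ j_n.
    by rewrite -s2c => /andP[? ?]; rewrite mulr_ge0 //= -(muln1 (n ^ 2)%N) PoszM ler_pM.
  by rewrite is_word_nat -expnS; apply: (wide_exp (k := 3) n0 ww).
have s3XY (i : nat) : store s3 12 i%:Z = store s2 12 i%:Z by case: fr3 => _ ->.
have s33 : regs s3 3 = b2z b.
  by case: fr3 => -> // _ _; case: fr2 => -> // _ _; case: fr1 => ->.
have nw (m : nat) : (m <= n)%N -> is_word w m%:Z.
  by move=> le; rewrite is_word_nat; apply: (wide_exp (k := 1) n0 ww).
pose f i := store s3 12 i%:Z == store s3 13 i%:Z.
apply: runs_weaken (leqnn _) _
  (@runs_all w s3 (Reg 0) (Bin Eqb (Read 12 (Reg 4)) (Read 13 (Reg 4))) n b f w0 _ s33 _ _).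
- move=> s [fr4 ->]; split; first exact: frame_trans fr3'' (sub4 _ _ fr4).
  congr (b2z (b && _)); apply/allP/eqP => [H|E k].
    apply/matrixP => i j; rewrite (ord1 j) -XYu -Zu -s3XY; apply/eqP/H.
    by rewrite mem_iota /=.
  rewrite mem_iota /= => k_n.
  by rewrite /f s3XY (XYu (Ordinal k_n)) (Zu (Ordinal k_n)) E.
- exact: nw.
- move=> s fr4; apply: eval_reg (nw _ _) => //; apply: reg0.
  exact: rdy_fr (frame_trans fr3'' (sub4 _ _ fr4)).
- move=> i s i_n [_ ss _] s4.
  have e4 : eval w s (Reg 4) = Some i%:Z by apply: eval_reg s4 (nw _ _); apply: ltnW.
  apply: eval_eqb => //; apply: (eval_read e4); rewrite ?ss //.
    by rewrite s3XY XYub.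
  exact: Zub.
Qed.

Definition FreivaldsBody : cmd :=
  Seq Sample (foldr (fun p P => Seq (FreivaldsTest p) P) Skip products).

(** Array 10 lies outside the frame of each test, so the vector drawn once is still there for all
    five. *)
Lemma runs_freivalds_body w n (G : instance n) (M : sextuple n) st :
    wide w n -> ready G M st -> entries_ok G M -> regs st 3 = 1 ->
    (n <= size (coins st))%N ->
  runs w FreivaldsBody st (1300 * n ^ 2)
    (fun s => regs s 3 = b2z (all (freivalds_ok G M (coin_col n (coins st))) products)).
Proof.
move=> ww rdy ok st3 nc.
have n0 : (0 < n)%N := leq_ltn_trans (leq0n _) (ltn_ord (source G)).
have reg0 : regs st 0 = n%:Z by case: rdy.
apply: (@runs_weaken _ _ _ (40 * n ^ 2 + (size products * (250 * n ^ 2) + 1))%N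
  _ _ _ _ (fun _ => id)).
  by rewrite -mulnn /=; nia.
apply: runs_seq; apply: runs_weaken (leqnn _) _ (runs_sample n0 ww reg0 nc).
move=> s [[c fr] sc].
have {fr}[rs s3] : ready G M s /\ regs s 3 = b2z true.
  have rc : ready G M (State (regs st) (store st) c) by case: rdy.
  by split; [apply: ready_frame fr rc | case: fr => ->].
(* The induction runs over any list of products, with the verdict [b] reached so far. *)
suff gen l b s' : ready G M s' -> regs s' 3 = b2z b ->
    (forall i, (i < n)%N -> store s' 10 i%:Z = b2z (nth false (coins st) i)) ->
    all (fun p : nat * nat * nat => [&& p.1.1 < 10, p.1.2 < 10 & p.2 < 10]%N) l ->
    runs w (foldr (fun p P => Seq (FreivaldsTest p) P) Skip l) s' (size l * (250 * n ^ 2) + 1)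
      (fun s => regs s 3 = b2z (b && all (freivalds_ok G M (coin_col n (coins st))) l)).
  exact: (gen products true).
elim: l b s' {s rs s3 sc} => [|[[x y] z] l IHl] b s rs s3 sc /=.
  by move=> _; rewrite andbT; apply: runs_skip.
move=> /andP[xyz /IHl IH].
have -> : ((size l).+1 * (250 * n ^ 2) + 1 = 250 * n ^ 2 + (size l * (250 * n ^ 2) + 1))%N.
  by rewrite mulSn addnA.
apply: runs_seq; apply: runs_weaken (leqnn _) _ (runs_freivalds ww rs ok xyz s3 sc).
move=> s' [fr' s'3]; rewrite andbA; apply: IH s'3 _; first exact: ready_frame fr' rs.
by move=> i i_n; case: fr' => _ -> // _; apply: sc.
Qed.

(** * Error probability of the test *)

Definition toggle T (k : nat) (cs : T.-tuple bool) : T.-tuple bool :=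
  [tuple tnth cs i (+) (i == k :> nat) | i < T].

Lemma toggleK T k : involutive (@toggle T k).
Proof.
move=> cs; apply: eq_from_tnth => i; rewrite !tnth_mktuple.
by rewrite -addbA addbb addbF.
Qed.

(* Toggling the coin of a nonzero column of XY - Z repairs every failing run. *)
Lemma freivalds_half n T (X Y Z : 'M[int]_n) : (n <= T)%N -> X *m Y != Z ->
  (2 ^ T <= 2 * #|[pred cs : T.-tuple bool |
      X *m (Y *m coin_col n cs) != Z *m coin_col n cs]|)%N.
Proof.
move=> nT XYZ.
set good := [pred cs : T.-tuple bool | _].
have [i [j Dij]] : exists i, exists j, (X *m Y - Z) i j != 0.
  apply: contrapT => no; case/negP: XYZ; rewrite -subr_eq0; apply/eqP/matrixP => i j.
  rewrite [RHS]mxE; apply/eqP; apply: contrapT => /negP ne; apply: no.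
  by exists i, j.
have goodE (cs : T.-tuple bool) : (cs \in good) = ((X *m Y - Z) *m coin_col n cs != 0).
  by rewrite inE mulmxBl subr_eq0 mulmxA.
have toggled (cs : T.-tuple bool) : cs \notin good -> toggle j cs \in good.
  rewrite !goodE negbK => /eqP D0; apply/negP => /eqP.
  (* Toggling coin [j] adds plus or minus the [j]-th unit vector to u. With D = X Y - Z and D u = 0,
     the new image is plus or minus column [j] of D, whose entry in row [i] is nonzero. *)
  have -> : coin_col n (toggle j cs) = coin_col n cs
      + (if nth false cs j then -1 else 1) *: delta_mx j 0.
    apply/matrixP => k l; rewrite (ord1 l) !mxE eqxx andbT.
    have kT := leq_trans (ltn_ord k) nT.
    rewrite -[nth _ (toggle _ _) _]/(nth false (toggle j cs) (Ordinal kT)).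
    rewrite -tnth_nth tnth_mktuple /=.
    rewrite (tnth_nth false) /= val_eqE; case: eqVneq => [->|_]; last by rewrite addbF mulr0 addr0.
    by case: nth.
  rewrite mulmxDr D0 add0r -scalemxAr => /matrixP/(_ i 0).
  rewrite !mxE (bigD1 j) //= big1 ?addr0 => [|k /negPf kj]; last by rewrite !mxE kj mulr0.
  move: Dij; rewrite !mxE !eqxx /= mulr1 => /negPf Dij /eqP.
  by rewrite mulf_eq0 Dij orbF; case: nth.
have <- : #|{: T.-tuple bool}| = (2 ^ T)%N by rewrite card_tuple card_bool.
rewrite -(cardC good) mul2n -addnn leq_add2l.
(* The toggle is injective, so the image of [good] has the size of [good]; it contains the
   complement of [good]. *)
rewrite -(fintype.card_image (can_inj (@toggleK T j)) good).
apply: subset_leq_card; apply/fintype.subsetP => cs; rewrite inE => /toggled ncs.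
by apply/fintype.imageP; exists (toggle j cs); rewrite ?toggleK.
Qed.

Lemma rand_decided (R : realType) : separator_rand_decided_in_quadratic_time R.
Proof.
(* The checks take at most [500 * n ^ 2] steps and the test [1300 * n ^ 2], together below
   [2000 * n ^ 2], which also provides at least [n] coins. *)
exists (Decide FreivaldsBody), 8%N, 2000%N => d n G M d8 wM T run.
have n0 : (0 < n)%N := leq_ltn_trans (leq0n _) (ltn_ord (source G)).
have ww := wide_wordsize n d8.
have nT : (n <= T)%N by rewrite /T -mulnn; nia.
pose accept (cs : T.-tuple bool) :=
  entries_ok G M && all (freivalds_ok G M (coin_col n cs)) products.
have runP (cs : T.-tuple bool) : run cs (accept cs).
  have rdy : ready G M (separator_input G M cs) by [].
  have [|t [st [E le out]]] := @runs_decide _ _ G M FreivaldsBody (1300 * n ^ 2)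
    (all (freivalds_ok G M (coin_col n cs)) products) _ ww wM rdy.
    move=> s ok [_ _ cE] rs s3.
    have := runs_freivalds_body ww rs ok s3; rewrite cE /= size_tuple; exact.
  exists t, st; split=> //; apply: leq_trans le _.
  by rewrite /T -mulnDl leq_mul2r orbT.
have cardT : #|{: T.-tuple bool}| = (2 ^ T)%N by rewrite card_tuple card_bool.
have pos : 0 < (2 ^ T)%N%:R :> R by rewrite ltr0n expn_gt0.
split.
- by move=> cs; exists (accept cs).
- move=> /separatorP/andP[ok /allP pok]; rewrite /coin_prob.
  rewrite (_ : [set _ | _] = [set: T.-tuple bool]) ?cardsT ?cardT ?divff ?gt_eqF //.
  apply/setP => cs; rewrite !inE; apply/asboolP; rewrite (_ : true = accept cs) //.
  rewrite /accept ok; apply/esym/allP => -[[x y] z] /pok /eqP E.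
  by rewrite /freivalds_ok mulmxA E.
move=> nsep; rewrite /coin_prob ler_pdivlMr // mul1r mulrC ler_pdivrMr // -natrM ler_nat.
pose rej := [set cs : T.-tuple bool | ~~ accept cs].
apply: (@leq_trans (#|rej| * 2)); last first.
  rewrite leq_mul2r /=; apply: subset_leq_card; apply/fintype.subsetP => cs; rewrite !inE.
  by move=> /negPf acc; have := runP cs; rewrite acc.
have [ok|nok] := boolP (entries_ok G M); last first.
  rewrite (_ : rej = [set: T.-tuple bool]) ?cardsT ?cardT ?leq_pmulr //.
  by apply/setP => cs; rewrite !inE /accept (negPf nok).
(* With all entries in order, a sextuple that is no separator violates one of the products. The test
   of this product alone rejects for at least half of the coin strings. *)
have /allPn[[[x y] z] pin pbad] : ~~ all (product_ok G M) products.
  by apply: contra_notN nsep => pok; apply/separatorP; rewrite ok andTb; exact: pok.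
apply: leq_trans (freivalds_half nT pbad) _; rewrite mulnC leq_mul2r /=.
apply: subset_leq_card; apply/fintype.subsetP => cs; rewrite !inE => bad.
by rewrite /accept ok andTb; apply/allPn; exists (x, y, z).
Qed.

(** * Subroutine calls on fresh registers and arrays *)

(* The sixteen namespaces [shift c], c < 16, are disjoint and avoid 0, ..., 15. *)
Definition shift (c r : nat) : nat := r.+1 * 16 + c.

Lemma shift_inj c c' r r' : (c < 16)%N -> (c' < 16)%N ->
  (shift c r == shift c' r') = (c == c') && (r == r').
Proof. rewrite /shift; lia. Qed.

Lemma shift_geq c r k : (k < 16)%N -> (shift c r == k) = false.
Proof. rewrite /shift; lia. Qed.

Fixpoint shift_expr (c : nat) (e : expr) : expr :=
  match e with
  | Cst z => Cst z
  | Reg r => Reg (shift c r)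
  | Read a e1 => Read (shift c a) (shift_expr c e1)
  | Bin o e1 e2 => Bin o (shift_expr c e1) (shift_expr c e2)
  end.

Fixpoint shift_cmd (c : nat) (P : cmd) : cmd :=
  match P with
  | Skip => Skip
  | Assign r e => Assign (shift c r) (shift_expr c e)
  | Write a e1 e2 => Write (shift c a) (shift_expr c e1) (shift_expr c e2)
  | Flip r => Flip (shift c r)
  | Seq P1 P2 => Seq (shift_cmd c P1) (shift_cmd c P2)
  | If e P1 P2 => If (shift_expr c e) (shift_cmd c P1) (shift_cmd c P2)
  | While e P1 => While (shift_expr c e) (shift_cmd c P1)
  end.

(** The larger state [bst] carries a copy of [st] in namespace [c], and both have the same coins. *)
Definition sim (c : nat) (st bst : state) : Prop :=
  [/\ forall r, regs bst (shift c r) = regs st r,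
      forall a, store bst (shift c a) =1 store st a &
      coins bst = coins st].

Definition untouched (c : nat) (st st' : state) : Prop :=
  (forall r, (forall r', r != shift c r') -> regs st' r = regs st r) /\
  (forall a, (forall a', a != shift c a') -> store st' a = store st a).

Lemma untouched_trans c st1 st2 st3 :
  untouched c st1 st2 -> untouched c st2 st3 -> untouched c st1 st3.
Proof.
move=> [r1 a1] [r2 a2]; split=> [r nr|a na]; first by rewrite r2 // r1.
by rewrite a2 // a1.
Qed.

Lemma cost_shift c e : cost (shift_expr c e) = cost e.
Proof. by elim: e => //= [a e ->|o e1 -> e2 ->]. Qed.

Lemma eval_shift w c st bst e : sim c st bst ->
  eval w bst (shift_expr c e) = eval w st e.
Proof.
move=> [sr sa _]; elim: e => //= [r|a e ->|o e1 -> e2 ->] //; first by rewrite sr.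
by case: (eval w st e) => //= i; rewrite sa.
Qed.

Lemma sim_set_reg c st bst r x : (c < 16)%N -> sim c st bst ->
  sim c (set_reg st r x) (set_reg bst (shift c r) x) /\
  untouched c bst (set_reg bst (shift c r) x).
Proof.
move=> c16 [sr sa sc]; split; split=> //= r'.
  by rewrite shift_inj // eqxx sr.
by move=> /(_ r)/negPf->.
Qed.

Lemma sim_set_mem c st bst a i x : (c < 16)%N -> sim c st bst ->
  sim c (set_mem st a i x) (set_mem bst (shift c a) i x) /\
  untouched c bst (set_mem bst (shift c a) i x).
Proof.
move=> c16 [sr sa sc]; split; split=> //= a'.
  by move=> i'; rewrite shift_inj // eqxx sa.
by move=> /(_ a)/negPf na; apply/funext => i'; rewrite na.
Qed.

(** Renaming is injective and preserves costs, so each step of [P] is mirrored by a step of the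
    renamed program in equal time. The clause [untouched] protects the caller's data and the other
    namespaces. *)
Lemma exec_shift w c P st t st' : (c < 16)%N -> exec w P st t st' ->
  forall bst, sim c st bst ->
  exists2 bst', exec w (shift_cmd c P) bst t bst' & sim c st' bst' /\ untouched c bst bst'.
Proof.
move=> c16; elim=> {P st t st'}.
- by move=> st bst s; exists bst; [apply: exec_skip | split].
- move=> st r e x ev bst s; have H := sim_set_reg r x c16 s; eexists; last exact: H.
  by rewrite -(cost_shift c); apply: exec_assign; rewrite (eval_shift _ _ s).
- move=> st a e1 e2 i x ev1 ev2 bst s; have H := sim_set_mem a i x c16 s.
  eexists; last exact: H; rewrite -(cost_shift c e1) -(cost_shift c e2).
  by apply: exec_store; rewrite (eval_shift _ _ s).
- move=> rs m b cs r [brs bm bcs] [/= sr sa ->].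
  have s : sim c (State rs m cs) (State brs bm cs) by [].
  have [H1 H2] := sim_set_reg r (b2z b) c16 s.
  by eexists; [apply: exec_flip | split; [exact: H1 | exact: H2]].
- move=> P1 P2 st1 st2 st3 t1 t2 _ IH1 _ IH2 bst /IH1[bst2 E1 [/IH2[bst3 E2 [s3 u2]] u1]].
  by exists bst3; [apply: exec_seq E1 E2 | split=> //; apply: untouched_trans u1 u2].
- move=> st st' e x P1 P2 t ev _ IH bst s; have [bst' E H] := IH bst s.
  exists bst' => //; rewrite -(cost_shift c); apply: exec_if.
    by rewrite (eval_shift _ _ s); apply: ev.
  by case: ifP E.
- move=> st e P ev bst s; exists bst; last by [].
  by rewrite -(cost_shift c); apply: exec_while_stop; rewrite (eval_shift _ _ s).
- move=> st1 st2 st3 e x P t1 t2 ev x0 _ IH1 _ IH2 bst s.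
  have [bst2 E1 [/IH2[bst3 E2 [s3 u2]] u1]] := IH1 bst s.
  exists bst3; last by split=> //; apply: untouched_trans u1 u2.
  by rewrite -(cost_shift c); apply: exec_while_loop E1 E2; rewrite ?(eval_shift _ _ s) ?ev.
Qed.

Lemma exec_nocoin w P st t st' : exec w P st t st' -> coins st = [::] -> coins st' = [::].
Proof. by elim=> //= [? ? ? ? ? ? ? _ IH1 _ IH2 /IH1|? ? ? ? ? ? ? ? _ _ _ IH1 _ IH2 /IH1]. Qed.

(** * Checking the products by matrix multiplication *)

(** Rebuilds [matmul_input] inside namespace [c]: [n] in its register 0, the factors in its arrays 0
    and 1. The result is read from its array 2. *)
Definition ProductTest (P : cmd) (c : nat) (p : nat * nat * nat) : cmd :=
  let: (x, y, z) := p in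
  Seq (Assign (shift c 0) (Reg 0)) (Seq
    (For 4 Area (Seq (Write (shift c 0) (Reg 4) (cell x)) (Write (shift c 1) (Reg 4) (cell y))))
    (Seq (shift_cmd c P) (AllLoop Area (Bin Eqb (cell (shift c 2)) (cell z))))).

(** Each product uses a new namespace, because a run of [P] may leave arbitrary values behind
    whereas the next one must start from zeros. *)
Fixpoint ProductTests (P : cmd) (c : nat) (l : seq (nat * nat * nat)) : cmd :=
  if l is p :: l' then Seq (ProductTest P c p) (ProductTests P c.+1 l') else Skip.

Definition fresh (c : nat) (st : state) : Prop :=
  (forall r, regs st (shift c r) = 0) /\ (forall a i, store st (shift c a) i = 0).

Definition stage n (G : instance n) (M : sextuple n) (c : nat) (b : bool) (st : state) : Prop :=
  [/\ ready G M st, regs st 3 = b2z b, coins st = [::] &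
      forall c', (c <= c' < 16)%N -> fresh c' st].

(** The case [k = 2] of [matmul_exponent] at a fixed dimension, with a natural number as time
    bound. *)
Definition multiplies (w n T : nat) (P : cmd) : Prop :=
  forall A B : 'M[int]_n,
    (forall i j, `|A i j| <= (n.+1 ^ 2)%N%:Z) -> (forall i j, `|B i j| <= (n.+1 ^ 2)%N%:Z) ->
    runs w P (matmul_input A B) T
      (fun st => forall i j : 'I_n, store st 2 (i * n + j)%N%:Z = (A *m B) i j).

(** [sim] compares arrays at every integer index. Only indices in [0, n * n) get copied, so the
    loaded array has to be known to vanish elsewhere. *)
Lemma rowmajor_out n (A : 'M[int]_n) k :
  rowmajor A k = if 0 <= k < (n * n)%N%:Z then rowmajor A k else 0.
Proof.
case: ifP => // out; rewrite /rowmajor; case: pickP => // -[i j] /= /eqP E.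
move: out; rewrite E lez_nat ltz_nat leq0n /= => /negP[].
apply: (@leq_trans (i.+1 * n)); first by rewrite mulSn addnC ltn_add2r.
by rewrite leq_mul2r (ltn_ord i) orbT.
Qed.

Lemma fresh_frame R A c st st' :
  (forall r, shift c r \notin R) -> (forall a, shift c a \notin A) ->
  frame R A st st' -> fresh c st -> fresh c st'.
Proof.
move=> nR nA [rs ss _] [fr fa]; split=> [r|a i]; first by rewrite rs.
by rewrite ss.
Qed.

Lemma runs_product_test w n (G : instance n) (M : sextuple n) P T c x y z (b : bool) st :
    wide w n -> sextuple_words w M -> entries_ok G M -> multiplies w n T P ->
    (c < 16)%N -> [&& x < 10, y < 10 & z < 10]%N -> stage G M c b st ->
  runs w (ProductTest P c (x, y, z)) st (150 * n ^ 2 + T)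
    (stage G M c.+1 (b && product_ok G M (x, y, z))).
Proof.
move=> ww wM ok mulP c16 /and3P[x10 y10 z10] [rdy st3 stc stf].
have n0 : (0 < n)%N := leq_ltn_trans (leq0n _) (ltn_ord (source G)).
have w0 : (0 < w)%N := ltnW (wide_gt0 n0 ww).
have nat_w e m : (e <= 7)%N -> (m <= n ^ e)%N -> is_word w m%:Z.
  by move=> e7 le; rewrite is_word_nat; apply: wide_exp n0 ww e7 le.
have e0 s : ready G M s -> eval w s (Reg 0) = Some n%:Z.
  by case=> s0 _ _ _; apply: eval_reg s0 (nat_w 1%N _ _ _).
have eA s : ready G M s -> eval w s Area = Some (n * n)%N%:Z.
  move=> rs; apply: (eval_bin (e0 _ rs) (e0 _ rs)); first by rewrite /= PoszM.
  by apply: (nat_w 2%N).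
have e4 s k : (k < n * n)%N -> regs s 4 = k%:Z -> eval w s (Reg 4) = Some k%:Z.
  by move=> kn s4; apply: eval_reg s4 (nat_w 2%N _ _ _) => //; rewrite -mulnn ltnW.
have ecell s k a : ready G M s -> (a < 10)%N -> (k < n * n)%N -> regs s 4 = k%:Z ->
    eval w s (cell a) = Some (rowmajor (input_mx G M a) k%:Z).
  move=> [_ _ _ sa] a10 kn s4; apply: (eval_read (e4 _ _ kn s4)); first by rewrite sa.
  by apply: rowmajor_word; apply: input_mx_words.
pose R := [:: shift c 0; 4]%N; pose A := [:: shift c 0; shift c 1]%N.
have R3 : all (leq 3) R by apply/and3P; split; rewrite // /shift; lia.
have A10 : all (leq 10) A by apply/and3P; split; rewrite // /shift; lia.
have rdy_fr s : frame R A st s -> ready G M s by move=> fr; apply: ready_frame fr rdy.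
apply: (@runs_weaken _ _ _
  (2 + ((n * n * ((4 + 4) + 3 + 10) + (3 + 10)) + (T + (n * n * (5 + 3 + 13) + (3 + 10)))))%N
  _ _ _ _ (fun _ => id)).
  by rewrite -mulnn; nia.
apply: runs_seq; apply: (@runs_assign _ _ _ (Reg 0) n%:Z); first exact: e0.
set st1 := set_reg _ _ _.
have fr1 : frame R A st st1 by apply: frame_set_reg => //; rewrite mem_head.
have [str sta] : fresh c st by apply: stf; rewrite leqnn.
apply: runs_seq.
(* The namespace starts out fresh, so cells not yet copied read 0. *)
pose copied a i s := forall k : int, store s (shift c a) k =
  if 0 <= k < i%:Z then rowmajor (input_mx G M (if a == 0 then x else y)) k else 0.
pose Inv i s := [/\ frame R A st s, regs s 4 = i%:Z /\ regs s (shift c 0) = n%:Z,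
  copied 0%N i s & copied 1%N i s].
apply: (@runs_weaken _ _ _ (n * n * ((4 + 4) + 3 + 10) + (3 + 10))%N _ (Inv (n * n)%N)) => //;
  last first.
  apply: runs_for => //.
  - by rewrite -is_word_nat; apply: (nat_w 2%N).
  - by move=> i s i_n [fr [s4 _] _ _]; split=> //; apply/eA/rdy_fr.
  - split; first by apply: frame_set_reg => //; rewrite !inE eqxx orbT.
    + by split=> //; rewrite /st1 /= eqxx.
    + by move=> k /=; rewrite sta; case: ifP => //; lia.
    + by move=> k /=; rewrite sta; case: ifP => //; lia.
  move=> i s i_n [fr [s4 s0] cx cy]; have rs := rdy_fr _ fr.
  apply: runs_seq; apply: (@runs_write _ _ _ (Reg 4) (cell x) i%:Z
    (rowmajor (input_mx G M x) i%:Z)).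
  - exact: e4.
  - exact: ecell.
  set s1 := set_mem _ _ _ _.
  have fr1' : frame R A st s1 by apply: frame_set_mem => //; rewrite mem_head.
  have rs1 := rdy_fr _ fr1'.
  apply: (@runs_write _ _ _ (Reg 4) (cell y) i%:Z (rowmajor (input_mx G M y) i%:Z)).
  - exact: e4.
  - exact: ecell.
  split=> //; split.
  - apply: frame_set_reg; first by rewrite !inE eqxx orbT.
    by apply: frame_set_mem => //; rewrite !inE eqxx orbT.
  - by split=> //=; rewrite shift_geq.
  - move=> k /=; rewrite !shift_inj // !eqxx /= cx /=.
    by case: eqVneq => [->|ki]; [rewrite lez_nat ltz_nat leqnn | congr (if _ then _ else _); lia].
  - move=> k /=; rewrite !shift_inj // !eqxx /= cy /=.
    by case: eqVneq => [->|ki]; [rewrite lez_nat ltz_nat leqnn | congr (if _ then _ else _); lia].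
move=> s [fr [_ s0] cx cy]; have rs := rdy_fr _ fr.
have bound a i j : `|input_mx G M a i j| <= (n.+1 ^ 2)%N%:Z.
  have /andP[a0 an] := input_mx_range a i j ok.
  by rewrite ger0_norm // (le_trans an) // lez_nat leq_exp2r.
have [t [mst [E le mstE]]] := mulP _ _ (bound x) (bound y).
have s_sim : sim c (matmul_input (input_mx G M x) (input_mx G M y)) s.
  have [rs' ss' cs'] := fr; split; last by rewrite cs' stc.
    case=> [|r] /=; first exact: s0.
    rewrite rs' ?str ?nth_nil //.
    by rewrite !inE shift_inj // shift_geq // andbF.
  case=> [|[|a]] k.
  - by rewrite cx /= -rowmajor_out.
  - by rewrite cy /= -rowmajor_out.
  - rewrite ss' ?sta; last by rewrite !inE !shift_inj // !andbF.
    by rewrite /= /load_matrices nth_default // rowmajor0.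
have [s2 E2 [[sim_r sim_a sim_c] [un_r un_a]]] := exec_shift c16 E s_sim.
apply: runs_seq; exists t, s2; split=> //.
have s2c : coins s2 = [::] by rewrite sim_c; apply: exec_nocoin E _.
have low k : (k < 16)%N -> forall r, k != shift c r by move=> k16 r; rewrite eq_sym shift_geq.
have rs2 : ready G M s2.
  have [q0 q1 q2 qa] := rs; split; rewrite ?un_r ?un_a //; try exact: low.
  by move=> a a10; rewrite un_a ?qa //; apply: low; apply: leq_trans a10 _.
have s23 : regs s2 3 = b2z b.
  rewrite un_r; last exact: low.
  by have [fr3 _ _] := fr; rewrite fr3 // /R !inE eq_sym shift_geq.
have s2f c' : (c.+1 <= c' < 16)%N -> fresh c' s2.
  move=> /andP[cc' c'16]; have nc : c' == c = false by rewrite gtn_eqF.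
  have [fr' fa'] : fresh c' s.
    apply: fresh_frame fr (stf _ _) => [r|a|]; rewrite ?(ltnW cc') //.
      by rewrite !inE shift_inj // shift_geq // nc.
    by rewrite !inE !shift_inj // nc.
  split=> [r|a i]; [rewrite un_r // => r' | rewrite un_a // => r'];
    by rewrite shift_inj // nc.
have prodE (i j : 'I_n) : store s2 (shift c 2) (i * n + j)%N%:Z
    = (input_mx G M x *m input_mx G M y) i j.
  by rewrite sim_a mstE.
(* [P] is a black box, so the size of its output is recovered from the product itself: its entries
   are at most [n * (n ^ 2 * n ^ 2) = n ^ 5]. *)
have prodw k : (k < n * n)%N -> is_word w (store s2 (shift c 2) k%:Z).
  pose f k := is_word w (store s2 (shift c 2) k%:Z).
  suff /all_entries/allP H : forall i j : 'I_n, f (i * n + j)%N.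
    by move=> kn; apply: H; rewrite mem_iota.
  move=> i j; rewrite /f prodE.
  apply: is_word_le (mulmx_le (fun i j => input_mx_range x i j ok)
    (fun i j => input_mx_range y i j ok) i j) _.
  by apply: (nat_w 5%N) => //; rewrite -expnD -expnS.
pose f k := store s2 (shift c 2) k%:Z == rowmajor (input_mx G M z) k%:Z.
have rs2_fr s' : frame [:: 3; 4]%N [::] s2 s' -> ready G M s'.
  by move=> fr'; apply: ready_frame fr' rs2.
apply: runs_weaken (leqnn _) _ (@runs_all w s2 Area (Bin Eqb (cell (shift c 2)) (cell z))
  (n * n)%N b f w0 _ s23 _ _).
- move=> s' [fr' s'3]; split.
  + exact: rs2_fr.
  + rewrite s'3; congr (b2z (b && _)); apply/idP/eqP.
      move=> /all_entries H; apply/matrixP => i j; rewrite -prodE -rowmajorE; apply/eqP.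
      exact: H.
    by move=> Exy; apply/all_entries => i j; rewrite /f prodE Exy rowmajorE.
  + by case: fr' => _ _ ->.
  + by move=> c' /s2f; apply: fresh_frame fr'.
- by rewrite -is_word_nat; apply: (nat_w 2%N).
- by move=> s' fr'; apply/eA/rs2_fr.
- move=> k s' kn fr' s'4; apply: eval_eqb => //; last exact: ecell (rs2_fr _ fr') z10 kn s'4.
  by apply: (eval_read (e4 _ _ kn s'4)); [case: fr' => _ -> | apply: prodw].
Qed.

Lemma runs_product_tests w n (G : instance n) (M : sextuple n) P T c l (b : bool) st :
    wide w n -> sextuple_words w M -> entries_ok G M -> multiplies w n T P ->
    (c + size l <= 16)%N ->
    all (fun p : nat * nat * nat => [&& p.1.1 < 10, p.1.2 < 10 & p.2 < 10]%N) l ->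
    stage G M c b st ->
  runs w (ProductTests P c l) st (size l * (150 * n ^ 2 + T) + 1)
    (fun s => regs s 3 = b2z (b && all (product_ok G M) l)).
Proof.
move=> ww wM ok mulP; elim: l c b st => [|[[x y] z] l IHl] c b st /=.
  by move=> _ _ [_ st3 _ _]; apply: runs_skip; rewrite andbT.
move=> cl /andP[xyz l10] stg.
have -> : ((size l).+1 * (150 * n ^ 2 + T) + 1 =
   (150 * n ^ 2 + T) + (size l * (150 * n ^ 2 + T) + 1))%N by rewrite mulSn addnA.
apply: runs_seq.
apply: (runs_weaken (leqnn _) _ (runs_product_test ww wM ok mulP _ xyz stg)); last first.
  by apply: leq_trans cl; rewrite addnS ltnS leq_addr.
by move=> s stg'; rewrite andbA; apply: IHl stg'; rewrite // addSnnS.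
Qed.

(** * The exponent of matrix multiplication is at least 2 *)

(** Only [Write] alters the store, one cell at a time and at a cost of at least one step; cells
    changed by a composite run were changed in one of its parts. *)
Lemma exec_changes w P st t st' : exec w P st t st' -> forall a m,
  (#|[pred i : 'I_m | store st' a (i : nat)%:Z != store st a (i : nat)%:Z]| <= t)%N.
Proof.
have none (st1 st2 : state) a m t0 : store st1 = store st2 ->
    (#|[pred i : 'I_m | store st1 a (i : nat)%:Z != store st2 a (i : nat)%:Z]| <= t0)%N.
  by move=> ->; rewrite eq_card0 // => i; rewrite !inE eqxx.
have both (st1 st2 st3 : state) a m t1 t2 :
    (#|[pred i : 'I_m | store st2 a (i : nat)%:Z != store st1 a (i : nat)%:Z]| <= t1)%N ->
    (#|[pred i : 'I_m | store st3 a (i : nat)%:Z != store st2 a (i : nat)%:Z]| <= t2)%N ->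
    (#|[pred i : 'I_m | store st3 a (i : nat)%:Z != store st1 a (i : nat)%:Z]| <= t1 + t2)%N.
  move=> le1 le2; apply: leq_trans (leq_add le1 le2).
  rewrite -cardUI; apply: leq_trans (leq_addr _ _); apply: subset_leq_card.
  apply/fintype.subsetP => i; rewrite !inE.
  by case: (eqVneq (store st2 a _) (store st1 a _)) => [->|].
elim=> {P st t st'} //=; try by move=> *; apply: none.
- move=> st a e1 e2 i x _ _ a' m /=; apply: (@leq_trans 1); last by [].
  have Ei (j : 'I_m) : j \in [pred j : 'I_m |
      store (set_mem st a i x) a' (j : nat)%:Z != store st a' (j : nat)%:Z] -> (j : nat)%:Z = i.
    by rewrite inE /=; case: andP => [[_ /eqP]|_]; rewrite ?eqxx.
  by apply/card_le1_eqP => k l /Ei Ek /Ei; rewrite -Ek => -[/val_inj].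
- by move=> rs mem b cs r a m; rewrite eq_card0 // => i; rewrite !inE eqxx.
- by move=> P1 P2 st1 st2 st3 t1 t2 _ IH1 _ IH2 a m; apply: both (IH1 a m) (IH2 a m).
- move=> st st' e x P1 P2 t _ _ IH a m; apply: leq_trans (IH a m) _.
  by rewrite -addSn leq_addl.
- move=> st1 st2 st3 e x P t1 t2 _ _ _ IH1 _ IH2 a m.
  apply: leq_trans (both _ _ _ _ _ _ _ (IH1 a m) (IH2 a m)) _.
  by rewrite -addnA -addSn leq_addl.
Qed.

(* All n ^ 2 entries of the product of two all-ones matrices have to be written. *)
Lemma matmul_exponent_ge2 (R : realType) (omega : R) : matmul_exponent omega -> 2 <= omega.
Proof.
move=> /(_ 0%N)[P [d0 [C mulP]]]; rewrite leNgt; apply/negP => lt2.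
have sq n : (0 < n)%N -> (n ^ 2)%N%:R <= C%:R * powR n%:R omega :> R.
  move=> n0; pose A : 'M[int]_n := const_mx 1.
  have A1 i j : `|A i j| <= (n.+1 ^ 0)%N%:Z by rewrite mxE.
  have [t [st [E tC stE]]] := mulP d0 n A A (leqnn _) n0 A1 A1.
  apply: le_trans tC; rewrite ler_nat.
  apply: leq_trans (exec_changes E 2 (n * n)).
  rewrite -mulnn -[X in (X <= _)%N]card_ord; apply: subset_leq_card.
  (* Array 2 is initially zero, as only arrays 0 and 1 are loaded, while every entry of the product
     is positive. *)
  apply/fintype.subsetP => k _; rewrite inE /= /load_matrices nth_default // rowmajor0.
  pose f k := store st 2 k%:Z != 0.
  suff /all_entries/allP H : forall i j : 'I_n, f (i * n + j)%N.
    by apply: (H k); rewrite mem_iota /=.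
  move=> i j; rewrite /f stE gt_eqF //.
  have O : forall i j, 0 <= A i j by move=> ? ?; rewrite mxE.
  by apply: (mulmx_gt0 (k := i) O O); rewrite mxE.
pose e := 2 - omega; have e0 : 0 < e by rewrite subr_gt0.
have le n : (0 < n)%N -> powR n%:R e <= C%:R :> R.
  move=> n0; have := sq n n0.
  have p0 : 0 < powR (n%:R : R) omega by rewrite powR_gt0 // ltr0n.
  rewrite -ler_pdivrMr // natrX -powR_mulrn ?ler0n // -powRB //.
  by rewrite ?pnatr_eq0 -?lt0n ?n0 ?implybT.
(* The bound [n ^ e <= C] is refuted by any [n] of size at least the root of order [e] of
   [C + 1]. *)
pose y := powR (C.+1%:R : R) e^-1.
have y0 : 0 <= y by apply: powR_ge0.
pose n := (Num.truncn y).+1.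
have yn : y <= n%:R by rewrite ltW // truncnS_gt.
have := le n isT; apply/negP; rewrite -ltNge.
apply: (@lt_le_trans _ _ (powR y e)).
  by rewrite /y -powRrM mulVf ?gt_eqF // powRr1 ?ler0n // ltr_nat.
by rewrite ge0_ler_powR ?nnegrE ?ler0n // ltW.
Qed.

Lemma det_decided (R : realType) (omega : R) :
  matmul_exponent omega -> separator_decided_in_time omega.
Proof.
move=> mm; have omega2 := matmul_exponent_ge2 mm.
have [P [d0 [C mulP]]] := mm 2%N.
(* The word size must suit both the checks (8) and [P] ([d0]). The time is at most [500 * n ^ 2],
   plus five times [150 * n ^ 2 + T], plus 1. *)
exists (Decide (ProductTests P 0 products)), (maxn 8 d0), (1300 + 5 * C)%N.
move=> d n G M; rewrite geq_max => /andP[d8 dd0] wM.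
have n0 : (0 < n)%N := leq_ltn_trans (leq0n _) (ltn_ord (source G)).
have ww := wide_wordsize n d8.
pose T := Num.truncn (C%:R * powR n%:R omega : R).
have X0 : 0 <= C%:R * powR n%:R omega :> R by rewrite mulr_ge0 ?ler0n ?powR_ge0.
have mulT : multiplies (wordsize d n) n T P.
  move=> A B An Bn; have [t [st [E le stE]]] := mulP d n A B dd0 n0 An Bn.
  by exists t, st; split=> //; rewrite truncn_ge_nat.
have rdy : ready G M (separator_input G M [::]) by [].
have [|t [st [E le out]]] := @runs_decide _ _ G M (ProductTests P 0 products)
    (size products * (150 * n ^ 2 + T) + 1) (all (product_ok G M) products) _ ww wM rdy.
  move=> s ok [sr ss sc] rs s3.
  apply: (runs_product_tests (b := true) ww wM ok mulT) => //.
  (* Numbers of the form [shift c r] are at least 16, beyond the registers and arrays of the input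
     and the scratch registers 3 and 4, so they still hold the default 0. *)
  split=> // c' /andP[_ c16]; split=> [r|a i]; rewrite ?sr ?ss ?inE ?shift_geq //=.
  by rewrite /load_matrices nth_default ?rowmajor0 //= /shift; lia.
exists t, st; split=> //.
- have TX : T%:R <= C%:R * powR n%:R omega :> R by rewrite truncn_le.
  have n2 : (n ^ 2)%N%:R <= powR n%:R omega :> R.
    by rewrite natrX -powR_mulrn ?ler0n // ler_powR // ler1n.
  apply: (@le_trans _ _ (1300 * n ^ 2 + 5 * T)%N%:R).
    by rewrite ler_nat; apply: leq_trans le _; rewrite -mulnn /=; nia.
  have -> : (1300 + 5 * C)%N%:R = 1300 + 5 * C%:R :> R by rewrite natrD natrM.
  rewrite mulrDl -mulrA natrD [(1300 * _)%:R]natrM [(5 * _)%:R]natrM.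
  exact: lerD (ler_wpM2l (ler0n _ _) n2) (ler_wpM2l (ler0n _ _) TX).
- rewrite (_ : `[< _ >] = entries_ok G M && all (product_ok G M) products) //.
  by apply/asboolP/idP => /separatorP.
Qed.

Theorem theorem10 (R : realType) :
  [/\ (* (1) *)
      forall (n : nat) (G : instance n),
        no_instance G <-> exists M : sextuple n, separator G M,
      (* (2) *)
      forall omega : R,
        matmul_exponent omega -> separator_decided_in_time omega &
      (* (3) *)
      separator_rand_decided_in_quadratic_time R].
Proof.
split; [exact: no_instanceP | exact: det_decided | exact: rand_decided].
Qed.
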